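(* Let $A\in\mathbb{R}^{n\times d}$, $b\in\mathbb{R}^n$, $f(x):=\|Ax-b\|_2^2$ and $x^*=\arg\min_x f(x)$. Let $S_k\in\mathbb{R}^{m\times n}$, $k=1,\dots,q$, be independent Gaussian sketching matrices with $m>d+1$. Then the distributed randomized regression algorithm (described in the context) runs in time $O(md^2)$, and the error of the averaged solution $\bar{x}$ that it returns satisfies $$\frac{\mathbb{E}[f(\bar{x})]-f(x^* )}{f(x^* )}=\frac1q\,\frac{d}{m-d-1}.$$ Consequently, Markov's inequality implies that $\frac{f(\bar{x})-f(x^* )}{f(x^* )}\le\epsilon$ holds with probability at least $\left(1-\frac{1}{q\epsilon}\frac{d}{m-d-1}\right)$ for any $\epsilon>0$.
   Context: Distributed randomized regression: the input is $A$ and $b$; in parallel, each worker $k=1,\dots,q$ obtains the sketched data $S_kA$ and sketched output $S_kb$, solves $\hat{x}_k=\arg\min_x\|S_kAx-S_kb\|_2^2$ and sends $\hat{x}_k$ to the master node; the master node returns $\bar{x}=\frac1q\sum_{k=1}^q\hat{x}_k$. A Gaussian sketch is a random matrix $S\in\mathbb{R}^{m\times n}$ with i.i.d. zero-mean Gaussian entries, scaled so that $\mathbb{E}[S^TS]=I_n$ (that is, entries $\mathcal{N}(0,1/m)$). Expectations and probabilities are over the sketches only; $A$ and $b$ are deterministic.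
   Formalization: The minimizer x* is assumed unique (A of full column rank; the formula fails otherwise) and f(x* ) nonzero; the O(md^2) bound is for the parallel workers, and with the master's averaging the total time is O(md^2+qd). *)

(* Defs.v *)
From HB Require Import structures.
From mathcomp Require Import all_boot all_order all_algebra.
From mathcomp Require Import all_classical all_reals all_analysis.
Set Implicit Arguments.
Unset Strict Implicit.
Unset Printing Implicit Defensive.
Import Order.TTheory GRing.Theory Num.Theory.
Import numFieldNormedType.Exports.

Local Open Scope classical_set_scope.
Local Open Scope ring_scope.

(* Squared Euclidean norm; the library norm `|v| on matrices is the sup norm. *)
Definition sqnorm2 (R : realType) (n : nat) (v : 'cV[R]_n) : R :=
  \sum_(i < n) v i 0 ^+ 2.

Definition lsq (R : realType) (n d : nat) (A : 'M[R]_(n, d)) (b : 'cV[R]_n)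
  (x : 'cV[R]_d) : R := sqnorm2 (A *m x - b).

(* The set of all minimizers: "x is the argmin of f" is [argmin f = [set x]],
   "x is a minimizer of f" is [argmin f x]. *)
Definition argmin (R : realType) (T : Type) (f : T -> R) : set T :=
  [set x | forall y, f x <= f y].

(* Arithmetic programs over the reals with unit-cost instructions (algebraic
   computation trees). Inputs are indexed by I and outputs by O; an operand
   [Reg k] is the value produced by the k-th instruction executed so far
   (0 if there is none). Programs are first-order syntax, so the only way to
   use an input value is through a counted instruction. *)
Inductive operand (I : Type) : Type := Input of I | Reg of nat.

Inductive instr (R I : Type) : Type :=
  | Const of R
  | Add of operand I & operand I
  | Sub of operand I & operand I
  | Mul of operand I & operand I
  | Div of operand I & operand I
  | Sqrt of operand I.

Inductive program (R I O : Type) : Type :=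
  | Return of (O -> operand I)
  | Exec of instr R I & program R I O
  | IfLe of operand I & operand I & program R I O & program R I O.

Definition operand_val (R : realType) (I : Type) (x : I -> R) (regs : seq R)
  (a : operand I) : R :=
  match a with Input i => x i | Reg k => regs`_k end.

Definition instr_val (R : realType) (I : Type) (x : I -> R) (regs : seq R)
  (c : instr R I) : R :=
  let v := operand_val x regs in
  match c with
  | Const r => r
  | Add a b => v a + v b
  | Sub a b => v a - v b
  | Mul a b => v a * v b
  | Div a b => v a / v b
  | Sqrt a => Num.sqrt (v a)
  end.

(* Output of a program, and number of instructions and comparisons executed. *)
Fixpoint run (R : realType) (I O : Type) (x : I -> R) (regs : seq R)
  (p : program R I O) : (O -> R) * nat :=
  match p with
  | Return out => (fun o => operand_val x regs (out o), 0%N)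
  | Exec c p' =>
      let r := run x (rcons regs (instr_val x regs c)) p' in (r.1, r.2.+1)
  | IfLe a b p1 p2 =>
      let r := if operand_val x regs a <= operand_val x regs b
               then run x regs p1 else run x regs p2 in
      (r.1, r.2.+1)
  end.

Definition output (R : realType) (I O : Type) (p : program R I O)
  (x : I -> R) : O -> R := (run x [::] p).1.

Definition cost (R : realType) (I O : Type) (p : program R I O)
  (x : I -> R) : nat := (run x [::] p).2.

(* One program run by each of the q workers on its m x d sketched data and
   sketched output of length m, and one run by the master node on the q
   vectors that it receives. *)
Record dist_alg (R : realType) (q m d : nat) : Type := DistAlg {
  worker : program R ('I_m * 'I_d + 'I_m)%type 'I_d;
  master : program R ('I_q * 'I_d)%type 'I_d }.

Definition worker_input (R : realType) (m d : nat) (M : 'M[R]_(m, d))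
  (y : 'cV[R]_m) (u : 'I_m * 'I_d + 'I_m) : R :=
  match u with inl ij => M ij.1 ij.2 | inr i => y i 0 end.

Definition worker_output (R : realType) (q m d : nat) (alg : dist_alg R q m d)
  (M : 'M[R]_(m, d)) (y : 'cV[R]_m) : 'cV[R]_d :=
  \col_j output (worker alg) (worker_input M y) j.

Definition master_input (R : realType) (q d : nat) (xhat : 'I_q -> 'cV[R]_d)
  (u : 'I_q * 'I_d) : R := xhat u.1 u.2 0.

Definition master_output (R : realType) (q m d : nat) (alg : dist_alg R q m d)
  (xhat : 'I_q -> 'cV[R]_d) : 'cV[R]_d :=
  \col_j output (master alg) (master_input xhat) j.

Definition returned (R : realType) (q m d : nat) (alg : dist_alg R q m d)
  (SA : 'I_q -> 'M[R]_(m, d)) (Sb : 'I_q -> 'cV[R]_m) : 'cV[R]_d :=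
  master_output alg (fun k => worker_output alg (SA k) (Sb k)).

(* The workers run in parallel. *)
Definition workers_time (R : realType) (q m d : nat) (alg : dist_alg R q m d)
  (SA : 'I_q -> 'M[R]_(m, d)) (Sb : 'I_q -> 'cV[R]_m) : nat :=
  (\max_(k < q) cost (worker alg) (worker_input (SA k) (Sb k)))%N.

Definition running_time (R : realType) (q m d : nat) (alg : dist_alg R q m d)
  (SA : 'I_q -> 'M[R]_(m, d)) (Sb : 'I_q -> 'cV[R]_m) : nat :=
  (workers_time alg SA Sb +
   cost (master alg)
     (master_input (fun k => worker_output alg (SA k) (Sb k))))%N.

(* Each worker solves its least-squares problem and the master averages. When
   the sketched problem has several minimizers the worker may return any. *)
Definition dist_randomized_regression (R : realType) (q m d : nat)
  (alg : dist_alg R q m d) : Prop :=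
  (forall M y, argmin (lsq M y) (worker_output alg M y)) /\
  (forall xhat : 'I_q -> 'cV[R]_d,
     master_output alg xhat = q%:R^-1 *: \sum_(k < q) xhat k).

Definition mutually_independent (disp : measure_display)
  (T : measurableType disp) (R : realType) (P : probability T R)
  (I : finType) (F : I -> set (set T)) : Prop :=
  forall (J : {set I}) (E : I -> set T), (forall i, F i (E i)) ->
    P (\bigcap_(i in [set` J]) E i) = (\prod_(i in J) P (E i))%E.

Definition rmatrix (disp : measure_display) (T : measurableType disp)
  (R : realType) (P : probability T R) (m n : nat) : Type :=
  'I_m -> 'I_n -> {RV P >-> R}.

Definition rmatrix_val (disp : measure_display) (T : measurableType disp)
  (R : realType) (P : probability T R) (m n : nat) (S : rmatrix P m n)
  (w : T) : 'M[R]_(m, n) := \matrix_(i, j) S i j w.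

Definition sigma_rv (disp : measure_display) (T : measurableType disp)
  (R : realType) (P : probability T R) (X : {RV P >-> R}) : set (set T) :=
  [set X @^-1` B | B in measurable].

Definition sigma_rmatrix (disp : measure_display) (T : measurableType disp)
  (R : realType) (P : probability T R) (m n : nat) (S : rmatrix P m n) :
  set (set T) :=
  <<s \bigcup_(ij in [set: 'I_m * 'I_n]) sigma_rv (S ij.1 ij.2) >>.

(* I.i.d. N(0, 1/m) entries; [normal_prob] takes the standard deviation. *)
Definition gaussian_sketch (disp : measure_display) (T : measurableType disp)
  (R : realType) (P : probability T R) (m n : nat) (S : rmatrix P m n) :
  Prop :=
  (forall i j (B : set R), measurable B ->
     distribution P (S i j) B = normal_prob 0 (Num.sqrt m%:R^-1) B) /\
  mutually_independent P
    (fun ij : 'I_m * 'I_n => sigma_rv (S ij.1 ij.2)).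

(* Main.v *)
Require Import Defs.
From HB Require Import structures.
From mathcomp Require Import all_boot all_order all_algebra.
From mathcomp Require Import all_classical all_reals all_analysis.
From mathcomp Require Import measurable_realfun zify ring lra.
Set Implicit Arguments.
Unset Strict Implicit.
Unset Printing Implicit Defensive.
Import Order.TTheory GRing.Theory Num.Theory.
Import numFieldNormedType.Exports.

Local Open Scope classical_set_scope.
Local Open Scope ring_scope.

(** The first claim needs a program that returns a minimizer for every input,
    rank deficient ones included. Projecting the other columns and the
    right-hand side onto the orthogonal complement of the first column, and
    recursing, costs O(m d) instructions per column; as a quotient by zero is
    zero, a vanishing column needs no branching ([ols_argmin],
    [computes_ols]). Programs are handled through the sets of functions that
    they compute, so that no register is ever named ([computes_program]).

    For the second claim, let r = b - A xs be the optimal residual, so that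
    A^T r = 0 and f(x) - f(xs) = |A (x - xs)|^2. When A^T S^T S A is
    invertible, the solution x_k of a sketched problem satisfies
      A (x_k - xs) = K S^T S r  with  K = A (A^T S^T S A)^-1 A^T
    ([sketched_error]). No distribution of matrices is computed: everything
    follows from Gaussian integration by parts, E[S_ij g(S)] = E[d_ij g(S)] / m
    ([stein], [matrix_stein]), where freezing all the entries but one uses
    their independence ([indep_integral]). To make all functions smooth with
    integrable growth, S^T S is first replaced by S^T S + delta, which gives a
    resolvent K_delta with entries bounded by 1 / delta ([Kreg_le]). Its
    derivative is -K_delta (E^T S + S^T E) K_delta, and integration by parts
    yields three exact identities:
    - applied to S K_delta, it gives
        m d = E[(m - d - 1) tr K_delta
                + delta (m tr K_delta + tr K_delta^2 + (tr K_delta)^2)]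
      ([expect_trace]);
    - applied to S K_delta^2 S^T S r r^T, most terms vanish because
      K_delta r = 0, and it gives
        E|K_delta S^T S r|^2 = |r|^2 E[tr K_delta - delta tr K_delta^2] / m
      ([expect_sqnorm2]);
    - applied to S K_delta e_a r^T, it gives E[(K_delta S^T S r)_a] = 0
      ([expect_entry]).
    Where A^T S^T S A is singular, tr K_delta is at least 1 / delta, so the first
    identity, whose terms are nonnegative, shows that this almost surely does
    not happen ([ae_nonsingular]). There K_delta is dominated by K and tends to
    it when delta tends to 0; Fatou's lemma and dominated convergence
    ([limit_integral]) then give E[tr K] = m d / (m - d - 1), hence
    E|A (x_k - xs)|^2 = |r|^2 d / (m - d - 1), and E[A (x_k - xs)] = 0. By
    independence of the sketches the cross terms of the average vanish, and only
    a fraction 1 / q of the variance remains ([expect_average]).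

    The outputs of the workers are measurable because programs compute Borel
    functions ([measurable_run]), which is what makes these expectations
    meaningful for an arbitrary choice of the minimizers. *)

(** * Squared norms *)

Lemma sqnorm2E (R : realType) n (v : 'cV[R]_n) : sqnorm2 v = (v^T *m v) 0 0.
Proof. by rewrite mxE; apply: eq_bigr => i _; rewrite mxE expr2. Qed.

Lemma sqnorm2_ge0 (R : realType) n (v : 'cV[R]_n) : 0 <= sqnorm2 v.
Proof. by apply: sumr_ge0 => i _; rewrite sqr_ge0. Qed.

Lemma sqnorm2_eq0 (R : realType) n (v : 'cV[R]_n) :
  (sqnorm2 v == 0) = (v == 0).
Proof.
apply/eqP/eqP => [/eqP|->]; last first.
  by rewrite /sqnorm2 big1// => i _; rewrite mxE expr0n.
rewrite psumr_eq0 => [/allP v0|i _]; last exact: sqr_ge0.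
apply/matrixP => i j; rewrite ord1 mxE; apply/eqP.
by have := v0 i (mem_index_enum i); rewrite sqrf_eq0.
Qed.

Lemma dotmxC (R : realType) n (u v : 'cV[R]_n) :
  (u^T *m v) 0 0 = (v^T *m u) 0 0.
Proof. by rewrite !mxE; apply: eq_bigr => i _; rewrite !mxE mulrC. Qed.

Lemma sqnorm2D (R : realType) n (u v : 'cV[R]_n) :
  sqnorm2 (u + v) = sqnorm2 u + 2 * (u^T *m v) 0 0 + sqnorm2 v.
Proof.
rewrite !sqnorm2E [(u + v)^T]linearD/= mulmxDl !mulmxDr.
have -> : forall A B C D : 'M[R]_1, (A + B + (C + D)) 0 0 =
    A 0 0 + B 0 0 + (C 0 0 + D 0 0) by move=> A B C D; rewrite !mxE.
by rewrite (dotmxC v u); ring.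
Qed.

Lemma sqnorm2Z (R : realType) n (a : R) (v : 'cV[R]_n) :
  sqnorm2 (a *: v) = a ^+ 2 * sqnorm2 v.
Proof.
by rewrite mulr_sumr; apply: eq_bigr => i _; rewrite mxE exprMn.
Qed.

(** * Straight-line programs *)

Section straight_line.
Variables (R : realType) (I : Type).
Local Notation fn := ((I -> R) -> R).
Implicit Types (K F G : set fn) (f g : fn) (n : nat).

(** A program is described by the set of the functions of its input that it has
    computed so far; registers only appear when such a description is
    realized. *)
Inductive step K : fn -> Prop :=
  | StepConst r : step K (fun=> r)
  | StepAdd f g of K f & K g : step K (fun x => f x + g x)
  | StepSub f g of K f & K g : step K (fun x => f x - g x)
  | StepMul f g of K f & K g : step K (fun x => f x * g x)
  | StepDiv f g of K f & K g : step K (fun x => f x / g x).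

Inductive steps K : nat -> set fn -> Prop :=
  | Steps0 : steps K 0 K
  | StepsS n K' f of steps K n K' & step K' f : steps K n.+1 (K' `|` [set f]).

(** From the functions in [K], at most [n] instructions produce all those in
    [F]. *)
Definition computes K n F := exists n' K',
  [/\ (n' <= n)%N, steps K n' K' & F `<=` K'].

Lemma steps_subset K n K' : steps K n K' -> K `<=` K'.
Proof. by elim=> // {}n {}K' f _ IH _ g /IH; left. Qed.

Lemma step_mono K K' f : K `<=` K' -> step K f -> step K' f.
Proof. by move=> KK' [r|{}f g|{}f g|{}f g|{}f g]; constructor; exact: KK'. Qed.

Lemma steps_mono K L n K' : K `<=` L -> steps K n K' ->
  exists2 L', steps L n L' & K' `<=` L'.
Proof.
move=> KL; elim=> [|{}n {}K' f _ [L' sL K'L'] sf].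
  by exists L => //; exact: Steps0.
exists (L' `|` [set f]); first by apply: StepsS sL _; exact: step_mono sf.
by move=> g [/K'L'|]; [left|right].
Qed.

Lemma steps_trans K n K' p K'' :
  steps K n K' -> steps K' p K'' -> steps K (n + p) K''.
Proof.
move=> sK; elim=> [|{}p {}K'' f _ IH sf]; first by rewrite addn0.
by rewrite addnS; exact: StepsS IH sf.
Qed.

Lemma computes0 K F : F `<=` K -> computes K 0 F.
Proof. by move=> FK; exists 0%N, K; split => //; exact: Steps0. Qed.

Lemma computes1 K f : step K f -> computes K 1 [set f].
Proof.
move=> sf; exists 1%N, (K `|` [set f]); split=> //.
by apply: StepsS sf; exact: Steps0.
Qed.

Lemma computes_le K n p F : (n <= p)%N -> computes K n F -> computes K p F.
Proof.
by move=> np [n' [K' [n'n sK FK']]]; exists n', K'; split=> //; exact: leq_trans np.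
Qed.

Lemma computes_sub K n F G : computes K n F -> G `<=` F -> computes K n G.
Proof.
by move=> [n' [K' [n'n sK FK']]] GF; exists n', K'; split=> // g /GF/FK'.
Qed.

Lemma computes_mono K L n F : K `<=` L -> computes K n F -> computes L n F.
Proof.
move=> KL [n' [K' [n'n sK FK']]]; have [L' sL K'L'] := steps_mono KL sK.
by exists n', L'; split=> // g /FK'/K'L'.
Qed.

Lemma computes_trans K n p F G :
  computes K n F -> computes (K `|` F) p G -> computes K (n + p) (F `|` G).
Proof.
move=> [n' [K' [n'n sK FK']]] [p' [K'' [p'p sK' GK'']]].
have [|L' sL K''L'] := @steps_mono _ K' _ _ _ sK'.
  by move=> f [/(steps_subset sK)|/FK'].
exists (n' + p')%N, L'; split; [exact: leq_add|exact: steps_trans sL|].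
by move=> f [/FK'/(steps_subset sL)|/GK''/K''L'].
Qed.

Lemma computes_then K n p F G :
  computes K n F -> computes (K `|` F) p G -> computes K (n + p) G.
Proof. by move=> cF cG; apply: computes_sub (computes_trans cF cG) _ => f; right. Qed.

Lemma computes_seq (J : eqType) (s : seq J) K n (f : J -> fn) :
  (forall j, j \in s -> computes K n [set f j]) ->
  computes K (size s * n) [set g | exists2 j, j \in s & g = f j].
Proof.
elim: s => [_|j s IH fs]; first by apply: computes0 => g [].
apply: (@computes_sub _ _ ([set f j] `|` [set g | exists2 j, j \in s & g = f j])).
  rewrite mulSn; apply: computes_trans; first by apply: fs; rewrite mem_head.
  apply: (@computes_mono K) => [g|]; first by left.
  by apply: IH => i si; apply: fs; rewrite in_cons si orbT.
move=> g [i]; rewrite in_cons => /orP[/eqP ->->|si ->]; first by left.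
by right; exists i.
Qed.

Lemma computes_family (J : finType) K n (f : J -> fn) :
  (forall j, computes K n [set f j]) -> computes K (#|J| * n) (range f).
Proof.
move=> fs; rewrite cardE; apply: (@computes_sub _ _ _ _ (computes_seq _)) => [j _|].
  exact: fs.
by move=> g [j _ <-]; exists j => //; rewrite mem_enum.
Qed.

Lemma computes_sum (p : nat) K (f : 'I_p -> fn) : (forall i, K (f i)) ->
  computes K p.+1 [set fun x => \sum_(i < p) f i x].
Proof.
elim: p f => [|p IH] f Kf.
  have -> : (fun x => \sum_(i < 0) f i x) = fun=> 0.
    by apply/funext => x; rewrite big_ord0.
  exact/computes1/StepConst.
rewrite -addn1; apply: (computes_then (IH _ (fun i => Kf (widen_ord _ i)))).
have -> : (fun x => \sum_(i < p.+1) f i x) =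
    (fun x => \sum_(i < p) f (widen_ord (leqnSn p) i) x + f ord_max x).
  by apply/funext => x; rewrite big_ord_recr.
by apply/computes1/StepAdd; [right|left; exact: Kf].
Qed.

Lemma computes_dot (p : nat) K (f g : 'I_p -> fn) :
  (forall i, K (f i)) -> (forall i, K (g i)) ->
  computes K (p + p.+1) [set fun x => \sum_(i < p) f i x * g i x].
Proof.
move=> Kf Kg; rewrite -[X in (X + _)%N]muln1.
have := @computes_family 'I_p K 1 (fun i x => f i x * g i x).
rewrite card_ord => /(_ _)/computes_then; apply.
  by move=> i; apply/computes1/StepMul.
by apply: computes_sum => i; right; exists i.
Qed.

(** ** Realization by programs *)

(** Reading beyond the executed instructions yields 0, a value that the next
    instruction would change; valid operands are stable. *)
Definition valid_operand (p : nat) (a : operand I) : Prop :=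
  match a with Input _ => True | Reg k => (k < p)%N end.

Definition represents (rs : seq fn) K := forall f, K f -> exists2 a,
  valid_operand (size rs) a &
  forall x, operand_val x [seq g x | g <- rs] a = f x.

Lemma operand_val_rcons x (rs : seq R) r a : valid_operand (size rs) a ->
  operand_val x (rcons rs r) a = operand_val x rs a.
Proof. by case: a => //= k krs; rewrite nth_rcons krs. Qed.

Lemma represents_step K rs f : represents rs K -> step K f ->
  exists c, (forall x, instr_val x [seq g x | g <- rs] c = f x) /\
            represents (rcons rs f) (K `|` [set f]).
Proof.
move=> rK sf.
have rK' : represents (rcons rs f) (K `|` [set f]).
  move=> g [/rK[a va ag]|->].
    exists a => [|x]; last by rewrite map_rcons operand_val_rcons ?size_map.
    by case: a va {ag} => //= k krs; rewrite size_rcons ltnS ltnW.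
  exists (Reg I (size rs)) => [|x /=]; first by rewrite /= size_rcons.
  by rewrite map_rcons nth_rcons size_map ltnn eqxx.
suff [c cf] : exists c, forall x, instr_val x [seq g x | g <- rs] c = f x.
  by exists c.
case: sf {rK'} => [r|{}f g Kf Kg|{}f g Kf Kg|{}f g Kf Kg|{}f g Kf Kg].
- by exists (Defs.Const I r).
all: have [a _ af] := rK _ Kf; have [b _ bg] := rK _ Kg.
- by exists (Defs.Add R a b) => x /=; rewrite af bg.
- by exists (Defs.Sub R a b) => x /=; rewrite af bg.
- by exists (Defs.Mul R a b) => x /=; rewrite af bg.
- by exists (Defs.Div R a b) => x /=; rewrite af bg.
Qed.

(** The continuation [p] reads registers that the added instructions fill. *)
Lemma steps_program (O : Type) K n K' rs : steps K n K' -> represents rs K ->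
  exists2 rs', represents rs' K' & forall p : program R I O, exists p', forall x,
    run x [seq g x | g <- rs] p' =
    ((run x [seq g x | g <- rs'] p).1, (run x [seq g x | g <- rs'] p).2 + n)%N.
Proof.
move=> sK rK; elim: sK => [|{}n {}K' f _ [rs' rK' IH] sf].
  by exists rs => // p; exists p => x; rewrite addn0 -surjective_pairing.
have [c [cf rf]] := represents_step rK' sf.
exists (rcons rs' f) => // p; have [p' p'E] := IH (Exec c p).
by exists p' => x; rewrite p'E /= cf map_rcons addnS addSn.
Qed.

Lemma computes_program (O : Type) n (h : O -> fn) :
  computes [set f | exists i, f = fun x => x i] n (range h) ->
  exists p : program R I O, forall x,
    (forall o, output p x o = h o x) /\ (cost p x <= n)%N.
Proof.
move=> [n' [K' [n'n sK hK']]].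
have rK : represents [::] [set f | exists i, f = fun x => x i].
  by move=> f [i ->]; exists (Input i).
have [rs' rK' prog] := steps_program O sK rK.
have /choice[a ah] : forall o, exists a : operand I, forall x,
    operand_val x [seq g x | g <- rs'] a = h o x.
  move=> o; have [|a _ ah] := rK' (h o); first by apply: hK'; exists o.
  by exists a.
have [p pE] := prog (Return R a).
by exists p => x; rewrite /output /cost pE /=.
Qed.

End straight_line.

(** * Least squares by successive projections *)

(** The coefficients on [u] of the orthogonal projections of the columns of [N];
    they are 0 when [u] is. *)
Definition proj_coef (R : realType) (m d : nat) (u : 'cV[R]_m)
  (N : 'M[R]_(m, d)) : 'rV[R]_d :=
  \row_j ((\sum_i u i 0 * N i j) / (\sum_i u i 0 * u i 0)).

Fixpoint ols (R : realType) (m d : nat) : 'M[R]_(m, d) -> 'cV[R]_m -> 'cV[R]_d :=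
  match d with
  | 0%N => fun _ _ => 0
  | d'.+1 => fun M y =>
      let u := lsubmx (M : 'M[R]_(m, 1 + d')) in
      let N := rsubmx (M : 'M[R]_(m, 1 + d')) in
      let z := ols (N - u *m proj_coef u N) (y - u *m proj_coef u y) in
      (col_mx (proj_coef u y - proj_coef u N *m z) z : 'cV[R]_(1 + d'))
  end.

Lemma proj_coefP (R : realType) (m d : nat) (u : 'cV[R]_m) (N : 'M[R]_(m, d)) :
  u^T *m (N - u *m proj_coef u N) = 0.
Proof.
have uu : \sum_i u i 0 * u i 0 = sqnorm2 u.
  by apply: eq_bigr => i _; rewrite expr2.
rewrite mulmxBr mulmxA [u^T *m u]mx11_scalar -sqnorm2E mul_scalar_mx.
apply/matrixP => i j; rewrite ord1 !mxE uu.
under eq_bigr do rewrite mxE.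
have [u0|u0] := eqVneq (sqnorm2 u) 0; last by field.
move/eqP: (u0); rewrite sqnorm2_eq0 => /eqP ->.
by rewrite big1 ?mul0r ?mulr0 ?subr0// => k _; rewrite mxE mul0r.
Qed.

(** The minimum over the first coordinate is reached when the residual is
    orthogonal to the first column, whatever the other coordinates are. *)
Lemma ols_argmin (R : realType) (m d : nat) (M : 'M[R]_(m, d)) (y : 'cV[R]_m) :
  argmin (lsq M y) (ols M y).
Proof.
elim: d M y => [|d IH] M y w.
  by rewrite (_ : w = ols M y)//; apply/matrixP => -[].
pose u := lsubmx (M : 'M[R]_(m, 1 + d)); pose N := rsubmx (M : 'M[R]_(m, 1 + d)).
have lsqE (t : 'cV[R]_1) (x : 'cV[R]_d) :
    lsq M y (col_mx t x) = sqnorm2 (u *m t + N *m x - y).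
  rewrite -(@mul_row_col _ m 1 d 1) hsubmxK.
  by [].
rewrite -[w](@vsubmxK _ 1 d 1) /= -/u -/N.
set cN := proj_coef _ N; set cy := proj_coef _ y.
set z := ols _ _; set s := usubmx _; set v := dsubmx _.
rewrite !lsqE.
have E t x : u *m t + N *m x - y =
    ((N - u *m cN) *m x - (y - u *m cy)) + u *m (t + cN *m x - cy).
  rewrite mulmxBl !(mulmxBr, mulmxDr) -!mulmxA !opprB mulmxN !addrA.
  set a := u *m t; set b := N *m x; set c := u *m (cN *m x); set e := u *m cy.
  by apply/matrixP => i j; rewrite !mxE; ring.
rewrite !E; have -> : cy - cN *m z + cN *m z - cy = 0 by rewrite subrK subrr.
rewrite mulmx0 addr0 [leRHS]sqnorm2D.
have -> : (((N - u *m cN) *m v - (y - u *m cy))^T *m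
    (u *m (s + cN *m v - cy))) 0 0 = 0.
  rewrite mulmxA -[X in X *m _]trmxK trmx_mul trmxK.
  have -> : u^T *m ((N - u *m cN) *m v - (y - u *m cy)) = 0.
    by rewrite [LHS]mulmxBr mulmxA !proj_coefP mul0mx subr0.
  by rewrite trmx0 mul0mx mxE.
rewrite mulr0 addr0; apply: (le_trans (IH _ _ v)).
by rewrite lerDl sqnorm2_ge0.
Qed.

(** One level of the recursion costs O(m d) instructions, mostly for the inner
    products with the first column and the projections of the other columns. *)
Lemma computes_ols (R : realType) (I : Type) (m d : nat)
    (K : set ((I -> R) -> R)) (M : 'I_m -> 'I_d -> (I -> R) -> R)
    (y : 'I_m -> (I -> R) -> R) :
  (0 < m)%N -> (forall i j, K (M i j)) -> (forall i, K (y i)) ->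
  computes K (11 * (m * d ^ 2)) (range (fun j x =>
    ols (\matrix_(i, j) M i j x) (\col_i y i x) j 0)).
Proof.
move=> m0; elim: d K M y => [|d IH] K M y KM Ky.
  by apply: (@computes_le _ _ _ 0) => //; apply: computes0 => f [[]].
pose Mx x : 'M[R]_(m, 1 + d) := \matrix_(i, j) M i j x.
pose yx x : 'cV[R]_m := \col_i y i x.
pose ux x := lsubmx (Mx x); pose Nx x := rsubmx (Mx x).
pose zx x := ols (Nx x - ux x *m proj_coef (ux x) (Nx x))
                 (yx x - ux x *m proj_coef (ux x) (yx x)).
(* the columns other than the first one, followed by the right-hand side *)
pose V (c : option 'I_d) i := if c is Some j then M i (rshift 1 j) else y i.
pose u i := M i (@lshift 1 d 0).
pose dotu c x := \sum_i u i x * V c i x.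
pose uu x := \sum_i u i x * u i x.
pose coef c x := dotu c x / uu x.
pose prod ci x := u ci.2 x * coef ci.1 x.
pose res ci x := V ci.1 ci.2 x - u ci.2 x * coef ci.1 x.
have Ku i : K (u i) by exact: KM.
have KV c i : K (V c i) by case: c => [j|]; [exact: KM|exact: Ky].
have c1 : computes K (m + m.+1) [set uu] by exact: computes_dot.
have c2 : computes (K `|` [set uu]) (d.+1 * (m + m.+1 + 1)) (range coef).
  have := @computes_family R I (option 'I_d) (K `|` [set uu]) (m + m.+1 + 1) coef.
  rewrite card_option card_ord => H; apply: H => c.
  apply: (@computes_then _ _ _ _ _ [set dotu c]).
    by apply: computes_dot => i; left.
  by apply/computes1/StepDiv; [right|left; right].
have c3 : computes (K `|` [set uu] `|` range coef) (d.+1 * m * 2) (range res).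
  have := @computes_family R I (option 'I_d * 'I_m)%type
    (K `|` [set uu] `|` range coef) 2 res.
  rewrite card_prod card_option !card_ord => H; apply: H => -[c i].
  apply: (@computes_then _ _ _ 1 1 [set prod (c, i)]).
    by apply/computes1/StepMul; [left; left|right; exists c].
  by apply/computes1/StepSub; [left; left; left|right].
have zE x : zx x = ols (\matrix_(i, j) res (Some j, i) x) (\col_i res (None, i) x).
  rewrite /zx; congr (ols _ _); apply/matrixP => i j;
    rewrite !mxE big_ord1 !mxE /res /=; congr (_ - _ * (_ / _));
    by apply: eq_bigr => k _; rewrite !mxE.
set K1 := K `|` [set uu] `|` range coef `|` range res.
have c4 : computes K1 (11 * (m * d ^ 2)) (range (fun j x => zx x j 0)).
  have -> : (fun j x => zx x j 0) = (fun j x => ols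
      (\matrix_(i, j) res (Some j, i) x) (\col_i res (None, i) x) j 0).
    by apply/funext => j; apply/funext => x; rewrite zE.
  by apply: IH => *; right; eexists.
pose cz x := \sum_j coef (Some j) x * zx x j 0.
have c5 : computes (K1 `|` range (fun j x => zx x j 0)) (d + d.+1 + 1)
    [set fun x => coef None x - cz x].
  apply: (@computes_then _ _ _ (d + d.+1) 1 [set cz]).
    by apply: computes_dot => j; [left; left; right; exists (Some j)|right; exists j].
  by apply/computes1/StepSub; [left; left; left; right; exists None|right].
have := computes_trans c4 c5.
move=> /(computes_then c3) /(computes_then c2) /(computes_then c1).
move=> /computes_le c; apply: computes_sub (c (11 * (m * d.+1 ^ 2))%N _) _.
  by nia.
move=> f [j _ <-].
case: (@split_ordP 1 d j) => [i ->|i ->]; [right|left].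
  rewrite /= ord1; apply/funext => x.
  apply: (etrans (@col_mxEu R 1 d 1
    (proj_coef (ux x) (yx x) - proj_coef (ux x) (Nx x) *m zx x) (zx x) 0 0)).
  rewrite !mxE; congr (_ / _ - _); try by apply: eq_bigr => k _; rewrite !mxE.
  apply: eq_bigr => k _; rewrite !mxE; congr (_ / _ * _);
    by apply: eq_bigr => l _; rewrite !mxE.
exists i => //; apply/funext => x.
exact: (esym (@col_mxEd R 1 d 1
    (proj_coef (ux x) (yx x) - proj_coef (ux x) (Nx x) *m zx x) (zx x) i 0)).
Qed.

(** * The algorithm *)

Lemma worker_program (R : realType) (m d : nat) : (0 < m)%N ->
  exists p : program R ('I_m * 'I_d + 'I_m)%type 'I_d, forall M y,
    (\col_j output p (worker_input M y) j = ols M y) /\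
    (cost p (worker_input M y) <= 11 * (m * d ^ 2))%N.
Proof.
move=> m0; have := @computes_ols R ('I_m * 'I_d + 'I_m)%type m d
  [set f | exists u, f = fun x => x u] (fun i j x => x (inl (i, j)))
  (fun i x => x (inr i)) m0.
case/(_ _ _)/computes_program => [i j|i|p pP]; try by eexists.
exists p => M y; have [po pc] := pP (worker_input M y); split=> //.
apply/colP => j; rewrite mxE po.
by congr (ols _ _ j 0); apply/matrixP => i k; rewrite !mxE ?ord1.
Qed.

Lemma master_program (R : realType) (q d : nat) : (0 < q)%N ->
  exists p : program R ('I_q * 'I_d)%type 'I_d, forall xhat : 'I_q -> 'cV[R]_d,
    (\col_j output p (master_input xhat) j = q%:R^-1 *: \sum_(k < q) xhat k) /\
    (cost p (master_input xhat) <= 4 * (q * d))%N.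
Proof.
move=> q0; pose K : set (('I_q * 'I_d -> R) -> R) :=
  [set f | exists u, f = fun x => x u].
pose s j (x : 'I_q * 'I_d -> R) := \sum_(k < q) x (k, j).
pose c (x : 'I_q * 'I_d -> R) : R := q%:R^-1.
have : computes K (#|'I_d| * (q.+1 + (1 + 1)))
    (range (fun (j : 'I_d) x => c x * s j x)).
  apply: computes_family => j.
  apply: (@computes_then _ _ _ _ _ [set s j]).
    by apply: computes_sum => k; exists (k, j).
  apply: (@computes_then _ _ _ _ _ [set c]); first exact/computes1/StepConst.
  by apply/computes1/StepMul; [right|left; right].
rewrite card_ord => /computes_program[p pP].
exists p => xhat; have [po pc] := pP (master_input xhat); split.
  apply/colP => j; rewrite mxE po mxE /c /s summxE; congr (_ * _).
by apply: (leq_trans pc); nia.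
Qed.

Lemma dist_alg_exists (R : realType) (q m d : nat) : (0 < q)%N -> (0 < m)%N ->
  exists alg : dist_alg R q m d, dist_randomized_regression alg /\
    forall (SA : 'I_q -> 'M[R]_(m, d)) (Sb : 'I_q -> 'cV[R]_m),
      (workers_time alg SA Sb <= 11 * (m * d ^ 2))%N /\
      (running_time alg SA Sb <= 11 * (m * d ^ 2 + q * d))%N.
Proof.
move=> q0 m0; have [w wP] := @worker_program R m d m0.
have [p pP] := @master_program R q d q0.
exists (DistAlg w p); split.
  split=> [M y|xhat]; last by rewrite /master_output (pP xhat).1.
  by rewrite /worker_output /= (wP M y).1; exact: ols_argmin.
move=> SA Sb; set alg := DistAlg w p.
have wt : (workers_time alg SA Sb <= 11 * (m * d ^ 2))%N.
  by apply/bigmax_leqP => k _; exact: (wP (SA k) (Sb k)).2.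
split=> //; rewrite /running_time mulnDr leq_add//.
by apply: (leq_trans (pP _).2); nia.
Qed.

(** * Measurability of the returned solution *)

Lemma measurable_inv (R : realType) : measurable_fun setT (@GRing.inv R).
Proof.
have -> : [set: R] = [set 0] `|` [set x | x != 0].
  by apply/seteqP; split=> // x _; have [->|x0] := eqVneq x 0; [left|right].
have o0 : open [set x : R | x != 0] by exact: open_neq.
apply/measurable_funU; [exact: measurable_set1| |].
  rewrite (_ : [set x | _] = ~` [set 0]); first by apply: measurableC; exact: measurable_set1.
  by apply/seteqP; split=> x /= /eqP.
split; first exact: measurable_fun_set1.
by apply: open_continuous_measurable_fun => // x /set_mem; exact: inv_continuous.
Qed.

(** All instructions are Borel functions of their operands, and a comparison
    splits the inputs along a measurable set. *)
Lemma measurable_run (R : realType) (I O : Type) (disp : measure_display)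
    (T : measurableType disp) (p : program R I O) (x : T -> I -> R) o :
  (forall i, measurable_fun setT (x ^~ i)) ->
  measurable_fun setT (fun w => output p (x w) o).
Proof.
move=> mx; rewrite /output.
suff mrun (regs : T -> seq R) N : (forall w, size (regs w) = N) ->
    (forall k, measurable_fun setT (fun w => (regs w)`_k)) ->
    measurable_fun setT (fun w => (run (x w) (regs w) p).1 o).
  by apply: (mrun (fun=> [::]) 0%N).
have mval (rs : T -> seq R) a : (forall k, measurable_fun setT (fun w => (rs w)`_k)) ->
    measurable_fun setT (fun w => operand_val (x w) (rs w) a).
  by move=> mrs; case: a => [i|k]; [exact: mx|exact: mrs].
elim: p regs N => [out|c p IH|a b p IHp q IHq] regs N sregs mregs /=.
- exact: mval.
- apply: (IH _ N.+1) => [w|k]; first by rewrite size_rcons sregs.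
  under eq_fun do rewrite nth_rcons sregs.
  case: (k < N)%N; first exact: mregs.
  case: (k == N); last exact: measurable_cst.
  case: c => [r|a b|a b|a b|a b|a] /=.
  + exact: measurable_cst.
  + by apply: measurable_funD; exact: mval.
  + by apply: measurable_funB; exact: mval.
  + by apply: measurable_funM; exact: mval.
  + apply: measurable_funM; first exact: mval.
    by apply: (measurableT_comp (@measurable_inv R)); exact: mval.
  + apply: (measurableT_comp (continuous_measurable_fun (@sqrt_continuous R))).
    exact: mval.
- rewrite (_ : (fun w => _) = (fun w => if operand_val (x w) (regs w) a <=
      operand_val (x w) (regs w) b then (run (x w) (regs w) p).1 o
      else (run (x w) (regs w) q).1 o)); last first.
    by apply/funext => w; case: ifP.
  apply: measurable_fun_ifT; [|exact: (IHp _ N)|exact: (IHq _ N)].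
  by apply: measurable_fun_ler; exact: mval.
Qed.

(** A Borel function of a matrix, encoded without a sigma-algebra on matrices:
    it maps measurable entries to a measurable function. *)
Definition borel (R : realType) (m n : nat) (g : 'M[R]_(m, n) -> R) : Prop :=
  forall (disp : measure_display) (T : measurableType disp) (F : T -> 'M[R]_(m, n)),
  (forall i j, measurable_fun setT (fun w => F w i j)) ->
  measurable_fun setT (fun w => g (F w)).

Lemma borel_worker (R : realType) (q m d n : nat) (alg : dist_alg R q m d)
    (A : 'M[R]_(n, d)) (b : 'cV[R]_n) j :
  borel (fun M : 'M[R]_(m, n) => worker_output alg (M *m A) (M *m b) j 0).
Proof.
move=> disp T F mF; under eq_fun do rewrite mxE.
have mM p (B : 'M[R]_(n, p)) i k : measurable_fun setT (fun w => (F w *m B) i k).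
  under eq_fun do rewrite mxE.
  by apply: measurable_sum => l; apply: measurable_funM.
apply: measurable_run => -[[i k]|i]; exact: mM.
Qed.

(** * The normal distribution *)

Section normal_integral.
Variable R : realType.
Local Notation mu := (@lebesgue_measure R).
Implicit Types (s : R) (f : R -> \bar R).

(** The density is a Radon-Nikodym derivative, unique almost everywhere. *)
Lemma normal_prob_integral s f : (normal_prob 0 s).-integrable setT f ->
  (\int[normal_prob 0 s]_x f x = \int[mu]_x (f x * (normal_pdf 0 s x)%:E))%E.
Proof.
move=> fi; have mf := measurable_int _ fi.
have dom := @normal_prob_dominates R 0 s.
rewrite -(Radon_Nikodym_change_of_variables dom)//=.
apply: ae_eq_integral => //.
- by apply: emeasurable_funM.
- apply: emeasurable_funM => //=; apply/measurableT_comp => //=.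
  exact: measurable_normal_pdf.
- apply: ae_eqe_mul2l => /=.
  rewrite Radon_NikodymE//=; case: cid => /= h [h1 h2 h3].
  apply: integral_ae_eq => //=.
  + by apply/measurableT_comp => //; exact: measurable_normal_pdf.
  + by move=> E _ mE; rewrite -h3.
Qed.

Lemma ge0_normal_prob_integral s f : (forall x, 0 <= f x)%E ->
  measurable_fun setT f ->
  (\int[normal_prob 0 s]_x f x = \int[mu]_x (f x * (normal_pdf 0 s x)%:E))%E.
Proof.
move=> f0 mf.
have dom := @normal_prob_dominates R 0 s.
rewrite -(Radon_Nikodym_SigmaFinite.change_of_variables dom)//=.
apply: ae_eq_integral => //.
- apply: emeasurable_funM => //; apply: (measurable_int mu).
  exact: Radon_Nikodym_SigmaFinite.f_integrable.
- apply: emeasurable_funM => //=; apply/measurableT_comp => //=.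
  exact: measurable_normal_pdf.
- apply: ae_eqe_mul2l => /=.
  apply: integral_ae_eq => //=.
  + exact: Radon_Nikodym_SigmaFinite.f_integrable.
  + by apply/measurableT_comp => //; exact: measurable_normal_pdf.
  + by move=> E _ mE; rewrite -Radon_Nikodym_SigmaFinite.f_integral.
Qed.

(** A Gaussian density absorbs an exponential at the cost of a larger
    variance. *)
Lemma exp_normal_pdf_le s (p : nat) : 0 < s -> exists2 C : R, 0 <= C &
  forall x, expR (p%:R * `|x|) * normal_pdf 0 s x <= C * normal_pdf 0 (2 * s) x.
Proof.
move=> s0; have s20 : 2 * s != 0 by rewrite mulf_neq0 ?gt_eqF.
have sN0 : s != 0 by rewrite gt_eqF.
exists (normal_peak s / normal_peak (2 * s) * expR (2 * p%:R ^+ 2 * s ^+ 2)).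
  by rewrite mulr_ge0 ?expR_ge0// divr_ge0// normal_peak_ge0.
move=> x; rewrite !normal_pdfE//.
rewrite [leRHS](_ : _ = normal_peak s *
    (expR (2 * p%:R ^+ 2 * s ^+ 2) * normal_fun 0 (2 * s) x)); last first.
  by field; rewrite gt_eqF// normal_peak_gt0.
rewrite mulrCA ler_wpM2l ?normal_peak_ge0// /normal_fun -!expRD ler_expR !subr0.
have [y xE] : exists y, x = y * s by exists (x / s); rewrite divfK.
have -> : `|x| = `|y| * s by rewrite xE normrM (gtr0_norm s0).
have -> : - x ^+ 2 / (s ^+ 2 *+ 2) = - `|y| ^+ 2 / 2.
  by rewrite real_normK ?num_real// xE; field.
have -> : - x ^+ 2 / ((2 * s) ^+ 2 *+ 2) = - `|y| ^+ 2 / 8.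
  by rewrite real_normK ?num_real// xE; field.
rewrite -subr_ge0.
have -> : 2 * p%:R ^+ 2 * s ^+ 2 + - `|y| ^+ 2 / 8 -
    (p%:R * (`|y| * s) + - `|y| ^+ 2 / 2) =
    (`|y| / 2 - p%:R * s) ^+ 2 + (p%:R * s) ^+ 2 + `|y| ^+ 2 / 8 by field.
by rewrite !addr_ge0 ?sqr_ge0// divr_ge0 ?sqr_ge0.
Qed.

Lemma normal_prob_exp_lty s (p : nat) : 0 < s ->
  (\int[normal_prob 0 s]_x (expR (p%:R * `|x|))%:E < +oo)%E.
Proof.
move=> s0; have [C C0 ub] := exp_normal_pdf_le p s0.
have me : measurable_fun setT (fun x : R => expR (p%:R * `|x|)).
  by apply: measurableT_comp => //; apply: measurable_funM.
rewrite ge0_normal_prob_integral//; last exact/measurable_EFinP.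
apply: (@le_lt_trans _ _ (\int[mu]_x (C%:E * (normal_pdf 0 (2 * s) x)%:E))%E).
  apply: ge0_le_integral => //=.
  - by move=> x _; rewrite lee_fin mulr_ge0 ?expR_ge0 ?normal_pdf_ge0.
  - apply/measurable_EFinP/measurable_funM => //; exact: measurable_normal_pdf.
  - apply/measurable_EFinP/measurable_funM => //; exact: measurable_normal_pdf.
  - by move=> x _; rewrite lee_fin.
rewrite integralZl//; last exact: integrable_normal_pdf.
by rewrite integral_normal_pdf mule1 ltry.
Qed.

End normal_integral.

Section stein.
Variable R : realType.
Local Notation mu := (@lebesgue_measure R).
Implicit Types (s : R).

Lemma normal_prob_exp_integrable s (f : R -> R) (C : R) (p : nat) : 0 < s ->
  measurable_fun setT f -> (forall x, `|f x| <= C * expR (p%:R * `|x|)) ->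
  (normal_prob 0 s).-integrable setT (EFin \o f).
Proof.
move=> s0 mf fle.
have C0 : 0 <= C by have := fle 0; rewrite normr0 mulr0 expR0 mulr1; exact: le_trans.
have : (normal_prob 0 s).-integrable setT
    (fun x => C%:E * (expR (p%:R * `|x|))%:E)%E.
  apply: integrableZl => //; apply/integrableP; split.
    apply/measurable_EFinP/measurableT_comp => //.
    by apply: measurable_funM => //; exact: measurableT_comp.
  under eq_integral do rewrite gee0_abs ?lee_fin ?expR_ge0//.
  exact: normal_prob_exp_lty.
apply: le_integrable => //; first exact/measurable_EFinP.
by move=> x _ /=; rewrite lee_fin (ger0_norm (mulr_ge0 C0 (expR_ge0 _))).
Qed.

Lemma is_derive_normal_pdf s (x : R) : s != 0 ->
  is_derive x 1 (normal_pdf 0 s) (- (x / s ^+ 2) * normal_pdf 0 s x).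
Proof.
move=> s0; rewrite (_ : normal_pdf 0 s = fun x =>
  normal_peak s * expR (- x ^+ 2 * (s ^+ 2 *+ 2)^-1)); last first.
  by apply/funext => y; rewrite normal_pdfE// /normal_fun subr0.
apply: is_derive_eq.
by rewrite /GRing.scale/=; field.
Qed.

Lemma normal_pdf_cvg0 s : 0 < s -> exists2 K : R, 0 <= K &
  forall n, normal_pdf 0 s n.+1%:R <= K * harmonic n /\
            normal_pdf 0 s (- n.+1%:R) <= K * harmonic n.
Proof.
move=> s0; have sN0 : s != 0 by rewrite gt_eqF.
exists (normal_peak s * (s ^+ 2 *+ 2)).
  by rewrite mulr_ge0 ?normal_peak_ge0// mulrn_wge0 ?sqr_ge0.
move=> n; suff H : normal_pdf 0 s n.+1%:R <= normal_peak s * (s ^+ 2 *+ 2) * harmonic n.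
  by split=> //; move: H; rewrite !normal_pdfE// /normal_fun !subr0 sqrrN.
rewrite normal_pdfE// -mulrA ler_wpM2l ?normal_peak_ge0// /normal_fun subr0 mulNr.
rewrite expRN invf_ple ?posrE ?expR_gt0//; last first.
  by rewrite mulr_gt0// ?invr_gt0// mulrn_wgt0// exprn_gt0.
apply: le_trans (expR_ge1Dx _); rewrite /= invfM invrK mulrC.
apply: (@le_trans _ _ (n.+1%:R ^+ 2 / (s ^+ 2 *+ 2))); last by rewrite lerDr.
rewrite ler_wpM2r ?invr_ge0 ?mulrn_wge0 ?sqr_ge0//.
by rewrite expr2 ler_peMl// ler1n.
Qed.

(** Gaussian integration by parts: the density satisfies an equation of the
    form pdf' = - x pdf / s^2, and the boundary terms vanish. *)
Lemma stein (s C : R) (p : nat) (g g' : R -> R) : 0 < s ->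
  (forall x : R, is_derive x 1 g (g' x)) -> continuous g' ->
  (forall x, `|g x| <= C * expR (p%:R * `|x|)) ->
  (forall x, `|g' x| <= C * expR (p%:R * `|x|)) ->
  (\int[normal_prob 0 s]_x (x * g x)%:E =
   (s ^+ 2)%:E * \int[normal_prob 0 s]_x (g' x)%:E)%E.
Proof.
move=> s0 dg cg' gle g'le; have sN0 : s != 0 by rewrite gt_eqF.
have C0 : 0 <= C by have := gle 0; rewrite normr0 mulr0 expR0 mulr1; exact: le_trans.
have cg : continuous g.
  by move=> x; apply: differentiable_continuous; apply/derivable1_diffP.
have mg := continuous_measurable_fun cg.
have mg' := continuous_measurable_fun cg'.
have cpdf := @continuous_normal_pdf R 0 s sN0.
have xgle x : `|x * g x| <= C * expR (p.+1%:R * `|x|).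
  rewrite normrM -addn1 natrD mulrDl mul1r expRD mulrCA mulrC mulrA.
  apply: ler_pM => //; first by rewrite mulrC.
  by apply: le_trans (expR_ge1Dx _); rewrite lerDr.
have ixg : (normal_prob 0 s).-integrable setT (EFin \o (fun x => x * g x)).
  apply: normal_prob_exp_integrable s0 _ xgle.
  exact: measurable_funM.
have ig' : (normal_prob 0 s).-integrable setT (EFin \o g').
  exact: normal_prob_exp_integrable s0 _ g'le.
have [C1 C10 absorb] := exp_normal_pdf_le p.+1 s0.
have s20 : 0 < 2 * s by rewrite mulr_gt0.
have pdf_absorb (f : R -> R) : (forall x, `|f x| <= C * expR (p.+1%:R * `|x|)) ->
    forall x, `|f x * normal_pdf 0 s x| <= C * C1 * normal_pdf 0 (2 * s) x.
  move=> fle x; rewrite normrM (ger0_norm (normal_pdf_ge0 _ _ _)).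
  apply: (le_trans (ler_wpM2r (normal_pdf_ge0 _ _ _) (fle x))).
  by rewrite -!mulrA ler_wpM2l.
have gle' x : `|g x| <= C * expR (p.+1%:R * `|x|).
  apply: (le_trans (gle x)); rewrite ler_wpM2l// ler_expR ler_wpM2r//.
  by rewrite ler_nat.
have g'le' x : `|g' x| <= C * expR (p.+1%:R * `|x|).
  apply: (le_trans (g'le x)); rewrite ler_wpM2l// ler_expR ler_wpM2r//.
  by rewrite ler_nat.
pose h x := x * g x * normal_pdf 0 s x - s ^+ 2 * (g' x * normal_pdf 0 s x).
pose H x := - s ^+ 2 * (g x * normal_pdf 0 s x).
have dH (x : R) : is_derive x 1 H (h x).
  have := is_derive_normal_pdf x sN0 => dpdf.
  apply: is_derive_eq; rewrite /GRing.scale/= /h; field.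
  exact: sN0.
have ch : continuous h.
  move=> x; apply: cvgB.
    by apply: cvgM; [apply: cvgM; [exact: cvg_id|exact: cg]|exact: cpdf].
  by apply: cvgM; [exact: cvg_cst|apply: cvgM; [exact: cg'|exact: cpdf]].
pose G x := (C * C1 * (1 + s ^+ 2) * normal_pdf 0 (2 * s) x)%:E.
have hG x : `|h x| <= C * C1 * (1 + s ^+ 2) * normal_pdf 0 (2 * s) x.
  rewrite mulrDr mulr1 mulrDl; apply: (le_trans (ler_normB _ _)); apply: lerD.
    exact: (pdf_absorb _ xgle).
  rewrite normrM ger0_norm ?sqr_ge0//.
  rewrite [leRHS](_ : _ = s ^+ 2 * (C * C1 * normal_pdf 0 (2 * s) x)); last by ring.
  rewrite ler_wpM2l ?sqr_ge0//.
  exact: (pdf_absorb _ g'le').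
have iG : mu.-integrable setT G.
  rewrite /G; under eq_fun do rewrite EFinM.
  by apply: integrableZl => //; exact: integrable_normal_pdf.
pose D n : set R := `[(- n.+1%:R), n.+1%:R]%classic.
have int_h n : (\int[mu]_x ((h \_ (D n)) x)%:E = (H n.+1%:R)%:E - (H (- n.+1%:R))%:E)%E.
  transitivity (\int[mu]_(x in D n) (h x)%:E)%E.
    by rewrite [RHS]integral_mkcond; apply: eq_integral => x _; rewrite restrict_EFin.
  apply: (@continuous_FTC2 _ h H).
  - by rewrite gtrN.
  - exact: continuous_subspaceT.
  - have cH x : {for x, continuous H}.
      by apply: differentiable_continuous; apply/derivable1_diffP.
    split; first by move=> x _; exact: (@ex_derive _ _ _ _ _ _ _ (dH x)).
      by apply: cvg_at_right_filter; exact: cH.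
    by apply: cvg_at_left_filter; exact: cH.
  - by move=> x _; rewrite derive1E; have := dH x => ?; rewrite derive_val.
have mh n : measurable_fun setT (h \_ (D n)).
  have mD : measurable (D n) by exact: measurable_itv.
  apply/(measurable_restrictT _ mD).
  apply: measurable_funTS; exact: continuous_measurable_fun.
have [_ _ hcvg] : [/\ mu.-integrable setT (EFin \o h),
    (fun n => \int[mu]_x `|((h \_ (D n)) x)%:E - (h x)%:E|)%E @ \oo --> 0%E &
    (fun n => \int[mu]_x ((h \_ (D n)) x)%:E)%E @ \oo --> (\int[mu]_x (h x)%:E)%E].
  apply: (@dominated_convergence _ _ R mu setT measurableT
    (fun n x => ((h \_ (D n)) x)%:E) (EFin \o h) G) => //.
  - by move=> n; apply/measurable_EFinP; exact: mh.
  - by apply/measurable_EFinP; exact: continuous_measurable_fun.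
  - apply/aeW => x _; apply: cvg_near_cst.
    exists (Num.truncn `|x|) => // n /= xn; congr EFin; rewrite patchE mem_set//.
    rewrite /D /= in_itv /= -ler_norml; apply: (le_trans (ltW (truncnS_gt _))).
    by rewrite ler_nat.
  - apply/aeW => x n _; rewrite lee_fin patchE; case: ifP => _; first exact: hG.
    by rewrite normr0; apply: le_trans (hG x).
have h0 : (\int[mu]_x (h x)%:E = 0)%E.
  have hE : (fun n => \int[mu]_x ((h \_ (D n)) x)%:E)%E =
      EFin \o (fun n => H n.+1%:R - H (- n.+1%:R)).
    by apply/funext => n; rewrite int_h -EFinB.
  rewrite hE in hcvg; apply: (cvg_unique _ hcvg) => //.
  apply: cvg_EFin; first exact: nearW.
  have [K K0 pdfK] := normal_pdf_cvg0 s20.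
  pose c := s ^+ 2 * (C * C1) * K *+ 2.
  have HK n : `|H n.+1%:R - H (- n.+1%:R)| <= c * harmonic n.
    rewrite /c mulr2n mulrDl; apply: (le_trans (ler_normB _ _)).
    have [pK nK] := pdfK n.
    have Hle x : normal_pdf 0 (2 * s) x <= K * harmonic n ->
        `|H x| <= s ^+ 2 * (C * C1) * K * harmonic n.
      move=> xK; rewrite /H normrM normrN (ger0_norm (sqr_ge0 s)).
      rewrite [leRHS](_ : _ = s ^+ 2 * (C * C1 * (K * harmonic n))); last by ring.
      rewrite ler_wpM2l ?sqr_ge0//; apply: (le_trans (pdf_absorb _ gle' _)).
      by rewrite ler_wpM2l// mulr_ge0.
    by apply: lerD; exact: Hle.
  have ch0 : c * harmonic n @[n --> \oo] --> 0.
    rewrite -[X in _ --> X](mulr0 c); apply: cvgM; [exact: cvg_cst|exact: cvg_harmonic].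
  apply: (@squeeze_cvgr _ _ _ _ (fun n => - (c * harmonic n)) (fun n => c * harmonic n)) => //.
    by apply: nearW => n; rewrite -ler_norml; exact: HK.
  by rewrite -[X in _ --> X]oppr0; exact: cvgN.
have pdf_integrable (f : R -> R) : measurable_fun setT f ->
    (forall x, `|f x| <= C * expR (p.+1%:R * `|x|)) ->
    mu.-integrable setT (EFin \o (fun x => f x * normal_pdf 0 s x)).
  move=> mf fle; have : mu.-integrable setT
      (fun x => (C * C1)%:E * (normal_pdf 0 (2 * s) x)%:E)%E.
    by apply: integrableZl => //; exact: integrable_normal_pdf.
  apply: le_integrable => //.
    by apply/measurable_EFinP/measurable_funM => //; exact: measurable_normal_pdf.
  move=> x _ /=; rewrite lee_fin (ger0_norm (mulr_ge0 (mulr_ge0 C0 C10) (normal_pdf_ge0 _ _ _))).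
  exact: pdf_absorb.
have i1 := pdf_integrable _ (measurable_funM (@measurable_id _ _ _) mg) xgle.
have i2 := pdf_integrable _ mg' g'le'.
rewrite (normal_prob_integral ixg) (normal_prob_integral ig').
have i3 : mu.-integrable setT (EFin \o (fun x => s ^+ 2 * (g' x * normal_pdf 0 s x))).
  exact: (integrableZl measurableT _ i2).
move: h0; rewrite /h; under eq_integral do rewrite EFinB.
rewrite integralB_EFin//.
have -> : (\int[mu]_x (s ^+ 2 * (g' x * normal_pdf 0 s x))%:E =
    (s ^+ 2)%:E * \int[mu]_x (g' x * normal_pdf 0 s x)%:E)%E.
  by rewrite -integralZl//; apply: eq_integral => x _; rewrite /= EFinM.
have /= fin1 := integrable_fin_num measurableT i1.
have /= fin2 := integrable_fin_num measurableT i2.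
move=> h0; rewrite /=.
transitivity (\int[mu]_x (x * g x * normal_pdf 0 s x)%:E)%E.
  by apply: eq_integral => x _; rewrite EFinM.
transitivity ((s ^+ 2)%:E * \int[mu]_x (g' x * normal_pdf 0 s x)%:E)%E; last first.
  by congr (_ * _)%E; apply: eq_integral => x _; rewrite EFinM.
move: h0; rewrite -(fineK fin1) -(fineK fin2) -EFinM -EFinB => -[/eqP].
by rewrite subr_eq0 => /eqP ->.
Qed.
End stein.

(** * Independence and product measures *)

Definition mfun_of d1 d2 (T1 : measurableType d1) (T2 : measurableType d2)
    (f : T1 -> T2) (mf : measurable_fun setT f) : {mfun T1 >-> T2} :=
  MeasurableFun.Pack (MeasurableFun.Class (isMeasurableFun.Build _ _ _ _ _ mf)).

(** The joint law of two independent variables is the product of their laws. *)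
Lemma indep_integral d d1 d2 (T : measurableType d) (T1 : measurableType d1)
    (T2 : measurableType d2) (R : realType) (P : probability T R)
    (X : {mfun T >-> T1}) (Y : {mfun T >-> T2}) (f : T1 * T2 -> \bar R) :
  (forall A B, measurable A -> measurable B ->
     P (X @^-1` A `&` Y @^-1` B) = P (X @^-1` A) * P (Y @^-1` B))%E ->
  measurable_fun setT f -> P.-integrable setT (fun w => f (X w, Y w)) ->
  (distribution P X \x distribution P Y)%E.-integrable setT f /\
  (\int[P]_w f (X w, Y w) = \int[distribution P X \x distribution P Y]_z f z)%E.
Proof.
move=> indep mf fi.
have mZ : measurable_fun setT (fun w => (X w, Y w)).
  by apply/measurable_fun_pairP; split.
pose Z : {mfun T >-> (T1 * T2)%type} := mfun_of mZ.
have E A : measurable A ->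
    distribution P Z A = (distribution P X \x distribution P Y)%E A.
  move=> mA; apply: esym; apply: product_measure_unique mA => B C mB mC.
  by rewrite /distribution /= /pushforward; exact: (indep B C mB mC).
have EI (g : T1 * T2 -> \bar R) : (\int[distribution P Z]_z g z =
    \int[distribution P X \x distribution P Y]_z g z)%E.
  by apply: eq_measure_integral => A mA _; exact: E.
have fiZ : (distribution P Z).-integrable setT f.
  exact: (@integrable_pushforward _ _ _ _ _ _ mZ).
split.
  by move/integrableP : fiZ => [_ fioo]; apply/integrableP; split=> //; rewrite -EI.
rewrite -EI; exact/esym/(@integral_pushforward _ _ _ _ _ _ mZ).
Qed.

(** Two finite measures that agree on a family stable by intersection agree on
    the sigma-algebra that it generates. *)
Lemma indep_generated d d1 (T : measurableType d) (T1 : measurableType d1)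
    (R : realType) (P : probability T R) (X : {mfun T >-> T1})
    (G : set (set T)) :
  G `<=` measurable -> setI_closed G -> G setT ->
  (forall A E, measurable A -> G E ->
     P (X @^-1` A `&` E) = P (X @^-1` A) * P E)%E ->
  forall A E, measurable A -> <<s G >> E ->
     (P (X @^-1` A `&` E) = P (X @^-1` A) * P E)%E.
Proof.
move=> Gm GI GT indep A E mA GE.
have mXA : measurable (X @^-1` A) by rewrite -[X in measurable X]setTI; exact: measurable_funP.
have PA0 : 0 <= fine (P (X @^-1` A)) by rewrite fine_ge0// measure_ge0.
pose m1 := mrestr P mXA.
pose m2 := mscale (NngNum PA0) P.
have m2E B : m2 B = (P (X @^-1` A) * P B)%E.
  by rewrite /m2 /mscale /= fineK// fin_num_measure.
suff : m1 E = m2 E by rewrite m2E /m1 /mrestr setIC.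
apply: (@g_sigma_algebra_measure_unique _ _ _ G Gm (fun=> setT)) => //.
- by rewrite bigcup_const//; exists 0%N.
- move=> B GB; apply: (etrans _ (esym (m2E B))).
  by rewrite -indep// setIC.
- move=> _; rewrite /= /mrestr setTI.
  by apply: (le_lt_trans (probability_le1 _ _)) => //; exact: ltry.
Qed.

(** The normal law lives on a copy of the reals that carries another measurable
    structure; the identity transports it. *)
Lemma measurable_id_measurableTypeR (R : realType) :
  measurable_fun setT (fun x : measurableTypeR R => x : R).
Proof. by move=> _ A mA; rewrite setTI. Qed.

Section normal_law.
Context d (T : measurableType d) (R : realType) (P : probability T R).
Variables (X : {RV P >-> R}) (s : R).
Hypothesis lawX : forall B : set R, measurable B ->
  distribution P X B = normal_prob 0 s B.

Let N := normal_prob 0 s.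
Let I : {mfun measurableTypeR R >-> R} := mfun_of (@measurable_id_measurableTypeR R).

Let law_integral (f : R -> \bar R) :
  (\int[distribution P X]_x f x = \int[distribution N I]_x f x)%E.
Proof. by apply: eq_measure_integral => A mA _; exact: lawX. Qed.

Lemma ge0_normal_law_integral (f : R -> \bar R) : measurable_fun setT f ->
  (forall x, 0 <= f x)%E ->
  (\int[distribution P X]_x f x = \int[normal_prob 0 s]_x f x)%E.
Proof. by move=> mf f0; rewrite law_integral ge0_integral_distribution. Qed.

Lemma normal_law_integral (f : R -> \bar R) : measurable_fun setT f ->
  (normal_prob 0 s).-integrable setT f ->
  (\int[distribution P X]_x f x = \int[normal_prob 0 s]_x f x)%E.
Proof. by move=> mf fi; rewrite law_integral integral_distribution. Qed.

End normal_law.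

(** * Tame functions of a matrix *)

Section tame.
Variables (R : realType) (m n : nat).
Local Notation mx := 'M[R]_(m, n).
Implicit Types (g h : mx -> R) (M E : mx).

Definition mxnorm1 M : R := \sum_(p : 'I_m * 'I_n) `|M p.1 p.2|.

(** Continuity is only needed along lines, where the one-dimensional identity is
    applied, and the growth bound is the one that
    Gaussian entries integrate and that products preserve. *)
Definition tame g : Prop :=
  [/\ borel g,
      (forall M E, continuous (fun x : R => g (M + x *: E))) &
      exists (C : R) (p : nat), forall M, `|g M| <= C * expR (p%:R * mxnorm1 M)].

Lemma mxnorm1_ge0 M : 0 <= mxnorm1 M.
Proof. exact: sumr_ge0. Qed.

Lemma growth_ge0 g (C : R) (p : nat) :
  (forall M, `|g M| <= C * expR (p%:R * mxnorm1 M)) -> 0 <= C.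
Proof.
move=> /(_ 0) /(le_trans (normr_ge0 _)).
by rewrite pmulr_lge0// expR_gt0.
Qed.

Lemma growth_le g (C D : R) (p q : nat) M : C <= D -> (p <= q)%N ->
  (forall M, `|g M| <= C * expR (p%:R * mxnorm1 M)) ->
  `|g M| <= D * expR (q%:R * mxnorm1 M).
Proof.
move=> CD pq gC; apply: (le_trans (gC M)); apply: ler_pM => //.
  exact: growth_ge0 gC.
by rewrite ler_expR ler_wpM2r ?mxnorm1_ge0// ler_nat.
Qed.

Lemma tame_cst (c : R) : tame (fun=> c).
Proof.
split=> [disp T F mF||]; first exact: measurable_cst.
  by move=> M E x; exact: cvg_cst.
by exists `|c|, 0%N => M; rewrite mul0r expR0 mulr1.
Qed.

Lemma tame_entry i j : tame (fun M => M i j).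
Proof.
split=> [disp T F mF|M E x|]; first exact: mF.
  under eq_fun do rewrite !mxE.
  by apply: cvgD; [exact: cvg_cst|apply: cvgM; [exact: cvg_id|exact: cvg_cst]].
exists 1, 1%N => M; rewrite !mul1r.
apply: le_trans (expR_ge1Dx _); rewrite /mxnorm1 (bigD1 (i, j))//=.
by rewrite addrCA lerDl addr_ge0// sumr_ge0.
Qed.

Lemma tameD g h : tame g -> tame h -> tame (fun M => g M + h M).
Proof.
move=> [bg cg [C [p gC]]] [bh ch [D [q hD]]].
split=> [disp T F mF|M E x|].
- by apply: measurable_funD; [exact: bg|exact: bh].
- by apply: cvgD; [exact: cg|exact: ch].
exists (C + D), (p + q)%N => M; rewrite mulrDl.
apply: (le_trans (ler_normD _ _)); apply: lerD.
  by apply: growth_le gC => //; exact: leq_addr.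
by apply: growth_le hD => //; exact: leq_addl.
Qed.

Lemma tameM g h : tame g -> tame h -> tame (fun M => g M * h M).
Proof.
move=> [bg cg [C [p gC]]] [bh ch [D [q hD]]].
split=> [disp T F mF|M E x|].
- by apply: measurable_funM; [exact: bg|exact: bh].
- by apply: cvgM; [exact: cg|exact: ch].
exists (C * D), (p + q)%N => M.
by rewrite natrD mulrDl expRD normrM mulrACA ler_pM.
Qed.

Lemma tameN g : tame g -> tame (fun M => - g M).
Proof.
by move=> tg; under eq_fun do rewrite -mulN1r; apply: tameM => //; exact: tame_cst.
Qed.

Lemma tameB g h : tame g -> tame h -> tame (fun M => g M - h M).
Proof. by move=> tg th; apply: tameD => //; exact: tameN. Qed.

Lemma tame_sum (I : Type) (s : seq I) (g : I -> mx -> R) :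
  (forall i, tame (g i)) -> tame (fun M => \sum_(i <- s) g i M).
Proof.
move=> tg; elim: s => [|i s IH].
  by under eq_fun do rewrite big_nil; exact: tame_cst.
by under eq_fun do rewrite big_cons; exact: tameD.
Qed.

(** [Dg M E] is the derivative of [g] at [M] in the direction [E]. *)
Definition smooth g (Dg : mx -> mx -> R) : Prop :=
  [/\ tame g, (forall E, tame (Dg ^~ E)) &
      forall M E (x : R),
        is_derive x 1 (fun y : R => g (M + y *: E)) (Dg (M + x *: E) E)].

End tame.

Section gaussian.
Variables (R : realType) (m n : nat).
Variables (disp : measure_display) (T : measurableType disp).
Variables (P : probability T R) (S : rmatrix P m n).
Hypotheses (m0 : (0 < m)%N) (gS : gaussian_sketch S).
Local Notation mx := 'M[R]_(m, n).
Local Notation sigma := (Num.sqrt (m%:R^-1 : R)).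
Local Notation Sw := (rmatrix_val S).
Implicit Types (g h : mx -> R).

Let sigma_gt0 : 0 < sigma.
Proof. by rewrite sqrtr_gt0 invr_gt0 ltr0n. Qed.

Lemma measurable_rmatrix g : borel g -> measurable_fun setT (fun w => g (Sw w)).
Proof.
by move=> bg; apply: bg => i j; under eq_fun do rewrite mxE; exact: measurable_funP.
Qed.

(** The sum is at most the number of terms times the largest one; this replaces
    the independence of the entries in the integrability of tame functions. *)
Lemma expR_sum_le (I : finType) (a : I -> R) : (forall i, 0 <= a i) ->
  expR (\sum_i a i) <= 1 + \sum_i expR (#|I|%:R * a i).
Proof.
move=> a0; case: (pickP (fun _ : I => true)) => [i0 _|I0]; last first.
  by rewrite big_pred0 ?expR0 ?lerDl ?sumr_ge0.
have [i _ imax] := @Order.TotalTheory.arg_maxP _ _ _ i0 xpredT a isT.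
apply: (@le_trans _ _ (expR (#|I|%:R * a i))).
  rewrite ler_expR mulr_natl -sumr_const; apply: ler_sum => j _.
  exact: imax.
by rewrite (bigD1 i)//= addrCA lerDl addr_ge0// sumr_ge0.
Qed.

Lemma sketch_exp_integrable i j (p : nat) :
  P.-integrable setT (fun w => (expR (p%:R * `|S i j w|))%:E).
Proof.
have me : measurable_fun setT (fun x : R => (expR (p%:R * `|x|))%:E).
  by apply/measurable_EFinP/measurableT_comp => //; apply: measurable_funM.
apply/integrableP; split.
  by apply: (measurableT_comp me); exact: measurable_funP.
under eq_integral do rewrite gee0_abs ?lee_fin ?expR_ge0//.
rewrite -(@ge0_integral_distribution _ _ _ _ _ P (S i j)
  (fun x => (expR (p%:R * `|x|))%:E))//.
rewrite (ge0_normal_law_integral (gS.1 i j))//.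
exact: normal_prob_exp_lty.
Qed.

Lemma tame_integrable g : tame g -> P.-integrable setT (EFin \o (fun w => g (Sw w))).
Proof.
move=> [bg _ [C [p gC]]]; have C0 := growth_ge0 gC.
pose k := (p * #|{: 'I_m * 'I_n}|)%N.
pose G w := C * (1 + \sum_(q : 'I_m * 'I_n) expR (k%:R * `|S q.1 q.2 w|)).
have iG : P.-integrable setT (EFin \o G).
  apply: (@eq_integrable _ _ _ _ _ measurableT (fun w => C%:E *
     (1 + \sum_(q : 'I_m * 'I_n) (expR (k%:R * `|S q.1 q.2 w|))%:E))%E).
    by move=> w _; rewrite /= /G EFinM EFinD sumEFin.
  apply: integrableZl => //; apply: integrableD => //.
    exact: finite_measure_integrable_cst.
  by apply: integrable_sum => // q _; exact: sketch_exp_integrable.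
move: iG; apply: le_integrable => //.
  by apply/measurable_EFinP; exact: measurable_rmatrix.
move=> w _; rewrite /= lee_fin; apply: le_trans (ler_norm _).
apply: (le_trans (gC _)); rewrite ler_wpM2l// /mxnorm1 mulr_sumr.
apply: (le_trans (expR_sum_le _)) => [q|]; first by rewrite mulr_ge0.
rewrite lerD2l; apply: ler_sum => q _; rewrite ler_expR /k natrM mxE.
by rewrite mulrCA mulrA.
Qed.

End gaussian.

(** * Integration by parts for Gaussian matrices *)

Definition upd (R : realType) m n (M : 'M[R]_(m, n)) (i : 'I_m) (j : 'I_n) (x : R) :
  'M[R]_(m, n) := \matrix_(a, b) if (a, b) == (i, j) then x else M a b.

Lemma updE (R : realType) m n (M : 'M[R]_(m, n)) i j x :
  upd M i j x = upd M i j 0 + x *: delta_mx i j.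
Proof.
apply/matrixP => a b; rewrite !mxE xpair_eqE.
by case: ifP => _; rewrite ?mulr1 ?mulr0 ?add0r ?addr0.
Qed.

Lemma mxnorm1_upd (R : realType) m n (M : 'M[R]_(m, n)) i j x :
  mxnorm1 (upd M i j x) = `|x| + mxnorm1 (upd M i j 0).
Proof.
rewrite /mxnorm1 (bigD1 (i, j))//= [in RHS](bigD1 (i, j))//= !mxE eqxx normr0 add0r.
congr (_ + _); apply: eq_bigr => -[a b] /= /negbTE ab.
by rewrite !mxE ab.
Qed.

Section matrix_stein.
Variables (R : realType) (m n : nat).
Variables (disp : measure_display) (T : measurableType disp).
Variables (P : probability T R) (S : rmatrix P m n).
Hypotheses (m0 : (0 < m)%N) (gS : gaussian_sketch S).
Local Notation mx := 'M[R]_(m, n).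
Local Notation sigma := (Num.sqrt (m%:R^-1 : R)).
Local Notation Sw := (rmatrix_val S).

Section one_entry.
Variables (i : 'I_m) (j : 'I_n).

(** A family stable by intersection that generates the sigma-algebra of all the
    entries other than S i j. *)
Let others : set (set T) := [set E | exists2 B : 'I_m * 'I_n -> set R,
  (forall p, measurable (B p)) &
  E = \bigcap_(p in [set` ~: [set (i, j)]]) (S p.1 p.2 @^-1` B p)].

Let mpre (p : 'I_m * 'I_n) (B : set R) : measurable B -> measurable (S p.1 p.2 @^-1` B).
Proof. by move=> mB; rewrite -[X in measurable X]setTI; exact: measurable_funP. Qed.

Let others_measurable : others `<=` measurable.
Proof.
move=> _ [B mB ->]; apply: fin_bigcap_measurable => //.
by move=> p _; exact: mpre.
Qed.

Let others_setI : setI_closed others.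
Proof.
move=> _ _ [B mB ->] [C mC ->]; exists (fun p => B p `&` C p).
  by move=> p; exact: measurableI.
by rewrite -bigcapI.
Qed.

Let others_setT : others setT.
Proof.
exists (fun=> setT) => //; apply/esym; rewrite -subTset => w _ p _ //.
Qed.

Let others_entry p B : p != (i, j) -> measurable B -> others (S p.1 p.2 @^-1` B).
Proof.
move=> pij mB; exists (fun q => if q == p then B else setT).
  by move=> q; case: ifP.
apply/seteqP; split=> w /=.
  by move=> Bw q _; case: eqP => // ->.
by move/(_ p); rewrite /= eqxx; apply; rewrite !inE.
Qed.

Let others_indep A E : measurable A -> others E ->
  (P (S i j @^-1` A `&` E) = P (S i j @^-1` A) * P E)%E.
Proof.
move=> mA [B mB ->].
pose C p := S p.1 p.2 @^-1` (if p == (i, j) then A else B p).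
have sC p : sigma_rv (S p.1 p.2) (C p).
  by exists (if p == (i, j) then A else B p) => //; case: ifP.
have CE : \bigcap_(p in [set` ~: [set (i, j)]]) (S p.1 p.2 @^-1` B p) =
    \bigcap_(p in [set` ~: [set (i, j)]]) C p.
  by apply: eq_bigcapr => p /=; rewrite /C !inE => /negbTE ->.
have -> : S i j @^-1` A `&` \bigcap_(p in [set` ~: [set (i, j)]]) (S p.1 p.2 @^-1` B p) =
    \bigcap_(p in [set` [set: 'I_m * 'I_n]%SET]) C p.
  rewrite CE; apply/seteqP; split=> w.
    move=> [Aw Cw] p _; have [->|pij] := eqVneq p (i, j); last first.
      by apply: Cw; rewrite /= !inE.
    by rewrite /C eqxx.
  move=> Cw; split; last by move=> p _; apply: Cw; rewrite /= inE.
  by have := Cw (i, j); rewrite /C eqxx; apply; rewrite /= inE.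
rewrite CE !(gS.2 _ C sC) (bigD1 (i, j)) ?inE//=; congr (_ * _)%E.
  by rewrite /C eqxx.
by apply: eq_bigl => p; rewrite !inE.
Qed.

Let T2 := g_sigma_algebraType others.

Let mY : measurable_fun setT (fun w : T => w : T2).
Proof.
move=> _ A mA; rewrite setTI.
by apply: (smallest_sub _ others_measurable) mA; exact: sigma_algebra_measurable.
Qed.

Let Y : {mfun T >-> T2} := mfun_of mY.

Let mS_others p : p != (i, j) -> measurable_fun setT (fun w : T2 => S p.1 p.2 w).
Proof.
move=> pij _ B mB; rewrite setTI; apply: sub_sigma_algebra.
exact: others_entry.
Qed.

Lemma borel_upd (g : mx -> R) : borel g ->
  measurable_fun setT (fun z : R * T2 => g (upd (Sw z.2) i j z.1)).
Proof.
apply => a b; have [ab|ab] := eqVneq (a, b) (i, j).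
  by under eq_fun do rewrite mxE ab eqxx; exact: measurable_fst.
under eq_fun do rewrite mxE (negbTE ab) mxE.
exact: (measurableT_comp (mS_others ab) measurable_snd).
Qed.

(** Given the other entries, the entry [S i j] is still normal. *)
Lemma entry_integral (h : R -> mx -> R) :
  measurable_fun setT (fun z : R * T2 => h z.1 (upd (Sw z.2) i j z.1)) ->
  P.-integrable setT (EFin \o (fun w => h (S i j w) (Sw w))) ->
  (forall w, (normal_prob 0 sigma).-integrable setT
     (EFin \o (fun x => h x (upd (Sw w) i j x)))) ->
  (\int[P]_w (h (S i j w) (Sw w))%:E = \int[distribution P Y]_w
    \int[normal_prob 0 sigma]_x (h x (upd (Sw w) i j x))%:E)%E.
Proof.
move=> mh ih nh.
pose f (z : R * T2) := (h z.1 (upd (Sw z.2) i j z.1))%:E.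
have updS w : upd (Sw w) i j (S i j w) = Sw w.
  by apply/matrixP => a b; rewrite !mxE; case: eqP => [[-> ->]|].
have fE : (fun w => f (S i j w, Y w)) = EFin \o (fun w => h (S i j w) (Sw w)).
  by apply/funext => w; rewrite /f /= updS.
have mf : measurable_fun setT f by apply/measurable_EFinP.
have [|||fi fE2] := @indep_integral _ _ _ T R T2 R P (S i j) Y f.
- move=> A B mA mB.
  exact: (@indep_generated _ _ _ _ _ P (S i j) others).
- by [].
- by rewrite fE.
have -> : (fun w => (h (S i j w) (Sw w))%:E) = (fun w => f (S i j w, Y w)).
  by rewrite fE.
rewrite fE2 -integral21_prod_meas1//; apply: eq_integral => w _.
rewrite /fubini_G (normal_law_integral (gS.1 i j))//.
  exact: (measurableT_comp mf (measurable_pair2 w)).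
exact: nh.
Qed.

(** The other entries are frozen by independence, and the one-dimensional
    identity is applied to the remaining one. *)
Lemma matrix_stein g Dg : smooth g Dg ->
  \int[P]_w (S i j w * g (Sw w)) =
  m%:R^-1 * \int[P]_w Dg (Sw w) (delta_mx i j).
Proof.
move=> [tg tDg dg]; have tD := tDg (delta_mx i j).
have s0 : 0 < sigma by rewrite sqrtr_gt0 invr_gt0 ltr0n.
have [bg cg [C [p gC]]] := tg; have [bD cD [C' [p' DC]]] := tD.
have line w x : upd (Sw w) i j x = upd (Sw w) i j 0 + x *: delta_mx i j by exact: updE.
have growth (h : mx -> R) (K : R) (q : nat) w :
    (forall M, `|h M| <= K * expR (q%:R * mxnorm1 M)) ->
    forall x, `|h (upd (Sw w) i j x)| <=
      K * expR (q%:R * mxnorm1 (upd (Sw w) i j 0)) * expR (q%:R * `|x|).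
  move=> hK x; apply: (le_trans (hK _)).
  by rewrite mxnorm1_upd mulrDr expRD (mulrC (expR _)) mulrA.
have C0 := growth_ge0 gC; have C'0 := growth_ge0 DC.
have gC1 M : `|g M| <= (C + C') * expR ((p + p')%:R * mxnorm1 M).
  by apply: growth_le gC; rewrite ?lerDl ?leq_addr.
have DC1 M : `|Dg M (delta_mx i j)| <= (C + C') * expR ((p + p')%:R * mxnorm1 M).
  apply: (@growth_le _ _ _ (Dg ^~ (delta_mx i j)) _ _ _ _ M _ _ DC).
    by rewrite lerDr.
  exact: leq_addl.
have mline w (h : mx -> R) : (forall M E, continuous (fun x : R => h (M + x *: E))) ->
    continuous (fun x => h (upd (Sw w) i j x)).
  by move=> ch; under eq_fun do rewrite line; exact: ch.
have tSg : tame (fun M : mx => M i j * g M) by apply: tameM => //; exact: tame_entry.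
have iN w (h : mx -> R) (K : R) (q : nat) : tame h ->
    (forall M, `|h M| <= K * expR (q%:R * mxnorm1 M)) ->
    (normal_prob 0 sigma).-integrable setT (EFin \o (fun x => h (upd (Sw w) i j x))).
  move=> [_ ch _] hK.
  apply: normal_prob_exp_integrable s0 _ (growth _ _ _ w hK).
  by apply: continuous_measurable_fun; exact: mline.
have [_ _ [K [q SgK]]] := tSg.
have updij w x : (upd (Sw w) i j x) i j = x by rewrite mxE eqxx.
have iSg w : (normal_prob 0 sigma).-integrable setT
    (EFin \o (fun x => x * g (upd (Sw w) i j x))).
  rewrite (_ : (fun x => _) = fun x =>
      (fun M : mx => M i j * g M) (upd (Sw w) i j x)); first exact: (iN w _ _ _ tSg SgK).
  by apply/funext => x /=; rewrite updij.
have iDg w : (normal_prob 0 sigma).-integrable setT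
    (EFin \o (fun x => Dg (upd (Sw w) i j x) (delta_mx i j))).
  exact: (iN w _ _ _ tD DC).
have tcD : tame (fun M => m%:R^-1 * Dg M (delta_mx i j)).
  by apply: tameM => //; exact: tame_cst.
have iSw : (fun w => S i j w * g (Sw w)) = (fun w => (fun M : mx => M i j * g M) (Sw w)).
  by apply/funext => w; rewrite /= mxE.
rewrite -RintegralZl//; last exact: (tame_integrable m0 gS tD).
congr fine.
rewrite (@entry_integral (fun x M => x * g M)); last 3 first.
- by apply: measurable_funM; [exact: measurable_fst|exact: (borel_upd bg)].
- by rewrite iSw; exact: (tame_integrable m0 gS tSg).
- exact: iSg.
rewrite (@entry_integral (fun x M => m%:R^-1 * Dg M (delta_mx i j))); last 3 first.
- by apply: measurable_funM; [exact: measurable_cst|exact: (borel_upd bD)].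
- exact: (tame_integrable m0 gS tcD).
- by move=> w; exact: (integrableZl measurableT _ (iDg w)).
apply: eq_integral => w _.
have dline (x : R) : is_derive x 1 (fun x => g (upd (Sw w) i j x))
    (Dg (upd (Sw w) i j x) (delta_mx i j)).
  by rewrite line (_ : (fun x => _) = fun x => g (upd (Sw w) i j 0 + x *: delta_mx i j))//;
    apply/funext => y; rewrite line.
apply: (etrans (@stein R sigma _ _ _ _ s0 dline (mline w (Dg ^~ (delta_mx i j)) cD)
  (growth _ _ _ w gC1) (growth _ _ _ w DC1))).
by rewrite sqr_sqrtr ?invr_ge0// -(integralZl measurableT (iDg w)).
Qed.
End one_entry.
End matrix_stein.

(** * The regularized resolvent *)

Section resolvent.
Variables (R : realType) (n d : nat) (A : 'M[R]_(n, d)).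
Implicit Types (H : 'M[R]_n).

Definition gram H : 'M[R]_d := A^T *m H *m A.

(** The inverse is written with the adjugate, so that its entries are visibly
    rational functions; it is zero when the determinant vanishes. *)
Definition adjinv (W : 'M[R]_d) : 'M[R]_d := (\det W)^-1 *: \adj W.

Definition resolvent H : 'M[R]_n := A *m adjinv (gram H) *m A^T.

Lemma adjinvK W : \det W != 0 -> adjinv W *m W = 1%:M.
Proof. by move=> W0; rewrite -scalemxAl mul_adj_mx scale_scalar_mx mulVf. Qed.

Lemma adjinvVK W : \det W != 0 -> W *m adjinv W = 1%:M.
Proof. by move=> W0; rewrite -scalemxAr mul_mx_adj scale_scalar_mx mulVf. Qed.

Lemma trmx_adjinv W : (adjinv W)^T = adjinv W^T.
Proof. by rewrite /adjinv linearZ/= trmx_adj det_tr. Qed.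

Lemma trmx_resolvent H : H^T = H -> (resolvent H)^T = resolvent H.
Proof.
move=> HT; rewrite /resolvent !trmx_mul trmxK trmx_adjinv mulmxA.
by rewrite /gram !trmx_mul trmxK HT mulmxA.
Qed.

(** Both differences are those of the inverses of the Gram matrices. *)
Lemma resolventB H1 H2 : \det (gram H1) != 0 -> \det (gram H2) != 0 ->
  resolvent H1 - resolvent H2 = resolvent H1 *m (H2 - H1) *m resolvent H2.
Proof.
move=> d1 d2; rewrite /resolvent.
set V1 := adjinv (gram H1); set V2 := adjinv (gram H2).
have -> : A *m V1 *m A^T *m (H2 - H1) *m (A *m V2 *m A^T) =
    A *m (V1 *m (gram H2 - gram H1) *m V2) *m A^T.
  by rewrite /gram -mulmxBl -mulmxBr !mulmxA.
rewrite mulmxBr mulmxBl adjinvK// mul1mx -(mulmxA V1) adjinvVK// mulmx1.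
by rewrite mulmxBr mulmxBl.
Qed.

Lemma resolventK H : \det (gram H) != 0 ->
  resolvent H *m H *m resolvent H = resolvent H.
Proof.
move=> d0; rewrite /resolvent.
have -> : A *m adjinv (gram H) *m A^T *m H *m (A *m adjinv (gram H) *m A^T) =
    A *m (adjinv (gram H) *m gram H *m adjinv (gram H)) *m A^T.
  by rewrite /gram !mulmxA.
by rewrite adjinvK// mul1mx.
Qed.

Lemma resolvent_mulA H : \det (gram H) != 0 -> resolvent H *m H *m A = A.
Proof.
move=> d0; rewrite /resolvent.
have -> : A *m adjinv (gram H) *m A^T *m H *m A = A *m (adjinv (gram H) *m gram H).
  by rewrite /gram !mulmxA.
by rewrite adjinvK// mulmx1.
Qed.

Lemma tr_resolvent H : \det (gram H) != 0 -> \tr (resolvent H *m H) = d%:R.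
Proof.
move=> d0; rewrite /resolvent -!mulmxA mxtrace_mulC.
have -> : adjinv (gram H) *m (A^T *m H) *m A = adjinv (gram H) *m gram H.
  by rewrite /gram !mulmxA.
by rewrite adjinvK// mxtrace1.
Qed.

Lemma resolvent_ker H (b : 'cV[R]_n) : A^T *m b = 0 -> resolvent H *m b = 0.
Proof. by move=> Ab; rewrite /resolvent -mulmxA Ab mulmx0. Qed.

End resolvent.

Lemma tr_gram_ge0 (R : realType) p q (B : 'M[R]_(p, q)) : 0 <= \tr (B^T *m B).
Proof.
apply: sumr_ge0 => j _; rewrite mxE; apply: sumr_ge0 => i _.
by rewrite mxE -expr2 sqr_ge0.
Qed.

Lemma quad_gram (R : realType) p q (B : 'M[R]_(p, q)) (v : 'cV[R]_q) :
  (v^T *m (B^T *m B) *m v) 0 0 = sqnorm2 (B *m v).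
Proof. by rewrite sqnorm2E trmx_mul !mulmxA. Qed.

Lemma quad_delta (R : realType) n (B : 'M[R]_n) i :
  ((delta_mx i 0 : 'cV[R]_n)^T *m B *m (delta_mx i 0 : 'cV[R]_n)) 0 0 = B i i.
Proof. by rewrite trmx_delta -rowE -colE !mxE. Qed.

Lemma mxtrace_sqnorm2 (R : realType) n (v : 'cV[R]_n) : \tr (v^T *m v) = sqnorm2 v.
Proof. by rewrite sqnorm2E /mxtrace big_ord1. Qed.

Lemma tr_sub_rank1 (R : realType) n (k : 'M[R]_n) (a : 'cV[R]_n) (c : R) : k^T = k ->
  \tr ((k - c *: (a *m a^T))^T *m (k - c *: (a *m a^T))) =
  \tr (k *m k) - 2 * c * \tr (a^T *m (k *m a)) + c ^+ 2 * sqnorm2 a ^+ 2.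
Proof.
move=> kT; have -> : (k - c *: (a *m a^T))^T = k - c *: (a *m a^T).
  by rewrite linearB/= linearZ/= trmx_mul trmxK kT.
rewrite mulmxBl !mulmxBr -!(scalemxAl, scalemxAr) !linearB/= !linearZ/=.
have -> : \tr (k *m (a *m a^T)) = \tr (a^T *m (k *m a)).
  by rewrite mulmxA mxtrace_mulC.
have -> : \tr (a *m a^T *m k) = \tr (a^T *m (k *m a)).
  by rewrite -mulmxA mxtrace_mulC -mulmxA.
have -> : \tr (a *m a^T *m (a *m a^T)) = sqnorm2 a ^+ 2.
  have -> : a *m a^T *m (a *m a^T) = a *m (a^T *m a) *m a^T by rewrite !mulmxA.
  rewrite [a^T *m a]mx11_scalar -sqnorm2E mul_mx_scalar -scalemxAl.
  by rewrite linearZ/= mxtrace_mulC mxtrace_sqnorm2 expr2.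
rewrite /GRing.scale/=; ring.
Qed.

Section regularized.
Variables (R : realType) (m n d : nat) (A : 'M[R]_(n, d)).
Hypothesis A_inj : forall v : 'cV[R]_d, A *m v = 0 -> v = 0.
Implicit Types (M : 'M[R]_(m, n)) (delta : R).

(** The regularization is chosen so that the error terms below are traces of
    powers of the resolvent. *)
Definition reg delta M : 'M[R]_n := M^T *m M + delta%:M.
Definition Kreg delta M : 'M[R]_n := resolvent A (reg delta M).

Lemma trmx_reg delta M : (reg delta M)^T = reg delta M.
Proof. by rewrite /reg linearD/= trmx_mul trmxK tr_scalar_mx. Qed.

Lemma trmx_Kreg delta M : (Kreg delta M)^T = Kreg delta M.
Proof. exact/trmx_resolvent/trmx_reg. Qed.

Lemma det_reg delta M : 0 < delta -> \det (gram A (reg delta M)) != 0.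
Proof.
move=> delta0; apply/det0P => -[v v0 vW].
have : (v *m gram A (reg delta M) *m v^T) 0 0 = 0 by rewrite vW mul0mx mxE.
have -> : v *m gram A (reg delta M) *m v^T = (A *m v^T)^T *m reg delta M *m (A *m v^T).
  by rewrite /gram trmx_mul trmxK !mulmxA.
rewrite /reg mulmxDr mulmxDl mxE quad_gram mul_mx_scalar -scalemxAl mxE -sqnorm2E.
move/eqP; rewrite paddr_eq0 ?sqnorm2_ge0 ?mulr_ge0 ?sqnorm2_ge0// 1?ltW//.
rewrite mulf_eq0 (gt_eqF delta0) /= !sqnorm2_eq0 => /andP[_ /eqP/A_inj vT0].
by move/negP: v0; apply; rewrite -[v]trmxK vT0 trmx0.
Qed.

Lemma quad_reg delta M (v : 'cV[R]_n) : 
  (v^T *m reg delta M *m v) 0 0 = sqnorm2 (M *m v) + delta * sqnorm2 v.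
Proof.
by rewrite /reg mulmxDr mulmxDl mxE quad_gram mul_mx_scalar -scalemxAl mxE -sqnorm2E.
Qed.

Section positive.
Variables (delta : R) (M : 'M[R]_(m, n)).
Hypothesis delta0 : 0 < delta.
Local Notation K := (Kreg delta M).
Let d0 := det_reg M delta0.
Let KHK : K *m reg delta M *m K = K. Proof. exact: resolventK. Qed.

Lemma quad_Kreg (v : 'cV[R]_n) :
  (v^T *m K *m v) 0 0 = sqnorm2 (M *m (K *m v)) + delta * sqnorm2 (K *m v).
Proof.
by rewrite -quad_reg trmx_mul trmx_Kreg -[in LHS]KHK !mulmxA.
Qed.

Lemma Kreg_diag_ge0 i : 0 <= K i i.
Proof.
rewrite -quad_delta quad_Kreg.
by rewrite addr_ge0 ?sqnorm2_ge0// mulr_ge0 ?sqnorm2_ge0// ltW.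
Qed.

(** The resolvent is at most 1/delta as a positive form, because
    K (M^T M + delta) K = K. *)
Lemma Kreg_le i j : `|K i j| <= delta^-1.
Proof.
have Kij a b : delta * K a b ^+ 2 <= K b b.
  rewrite -[leRHS]quad_delta quad_Kreg -colE.
  apply: ler_wpDl; first exact: sqnorm2_ge0.
  have -> : K a b = (col b K) a 0 by rewrite [RHS]mxE.
  rewrite ler_pM2l// /sqnorm2 (bigD1 a)//= lerDl.
  by apply: sumr_ge0 => k _; rewrite sqr_ge0.
have Kjj : K j j <= delta^-1.
  have := Kij j j; have := Kreg_diag_ge0 j; rewrite le_eqVlt => /orP[/eqP <-|K0].
    by move=> _; rewrite invr_ge0 ltW.
  by rewrite expr2 mulrA ger_pMl// -[X in _ -> _ <= X]mulr1 ler_pdivlMl.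
rewrite -ler_sqr ?nnegrE ?invr_ge0 ?(ltW delta0)// real_normK ?num_real//.
rewrite -(ler_pM2l delta0); apply: (le_trans (Kij _ _)); apply: (le_trans Kjj).
by rewrite expr2 mulrA mulfV ?mul1r// gt_eqF.
Qed.

Lemma tr_KregN : \tr (K *m (M^T *m M)) = d%:R - delta * \tr K.
Proof.
have := tr_resolvent d0; rewrite -/K /reg mulmxDr linearD/= mul_mx_scalar linearZ/=.
by move=> <-; rewrite addrK.
Qed.

Lemma tr_KregNK : \tr (K *m (M^T *m M) *m K) = \tr K - delta * \tr (K *m K).
Proof.
have := congr1 mxtrace KHK.
rewrite [in LHS]/reg mulmxDr mulmxDl linearD/= mul_mx_scalar -scalemxAl linearZ/=.
by move=> <-; rewrite addrK.
Qed.

Lemma tr_Kreg_ge0 : 0 <= \tr K.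
Proof. by apply: sumr_ge0 => i _; exact: Kreg_diag_ge0. Qed.

Lemma tr_KregK_ge0 : 0 <= \tr (K *m K).
Proof. by rewrite -{1}trmx_Kreg tr_gram_ge0. Qed.

Lemma tr_KregK_le : delta * \tr (K *m K) <= \tr K.
Proof.
rewrite -subr_ge0 -tr_KregNK (_ : K *m _ *m K = (M *m K)^T *m (M *m K)).
  exact: tr_gram_ge0.
by move: (K) (trmx_Kreg delta M) => k kT; rewrite trmx_mul kT !mulmxA.
Qed.

Lemma tr_Kreg_le : delta * \tr K <= d%:R.
Proof.
rewrite -subr_ge0 -tr_KregN mulmxA mxtrace_mulC mulmxA.
rewrite -[in X in _ <= X]KHK.
have -> : M *m (K *m reg delta M *m K) *m M^T =
    (M *m K *m M^T)^T *m (M *m K *m M^T) + delta *: ((K *m M^T)^T *m (K *m M^T)).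
  move: (K) (trmx_Kreg delta M) => k kT.
  rewrite /reg mulmxDr mulmxDl mulmxDr mulmxDl mul_mx_scalar.
  by rewrite -!(scalemxAl, scalemxAr) !trmx_mul !trmxK kT !mulmxA.
by rewrite linearD/= linearZ/= addr_ge0 ?tr_gram_ge0// mulr_ge0 ?tr_gram_ge0// ltW.
Qed.

(** On the kernel of the sketched Gram matrix the regularized resolvent has the
    eigenvalue 1/delta, hence a large Frobenius norm. *)
Lemma tr_Kreg_singular : \det (gram A (reg 0 M)) = 0 -> 1 <= delta * \tr K.
Proof.
move/eqP/det0P => [v v0 vW].
have : (v *m gram A (reg 0 M) *m v^T) 0 0 = 0 by rewrite vW mul0mx mxE.
have -> : v *m gram A (reg 0 M) *m v^T = (A *m v^T)^T *m reg 0 M *m (A *m v^T).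
  by rewrite /gram trmx_mul trmxK !mulmxA.
rewrite quad_reg mul0r addr0 => /eqP; rewrite sqnorm2_eq0 => /eqP MAv.
set a := A *m v^T in MAv.
have a0 : sqnorm2 a != 0.
  rewrite sqnorm2_eq0; apply: contra v0 => /eqP/A_inj vT0.
  by rewrite -[v]trmxK vT0 trmx0.
have Ka : delta *: (K *m a) = a.
  rewrite -[RHS]/(A *m v^T) -[in RHS](resolvent_mulA d0) -/K -mulmxA.
  by rewrite -/a -mulmxA /reg mulmxDl -mulmxA MAv mulmx0 add0r mul_scalar_mx scalemxAr.
apply: le_trans (ler_wpM2l (ltW delta0) tr_KregK_le).
pose c := (delta * sqnorm2 a)^-1.
have := tr_gram_ge0 (K - c *: (a *m a^T)).
rewrite tr_sub_rank1 ?trmx_Kreg//.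
have -> : \tr (a^T *m (K *m a)) = delta^-1 * sqnorm2 a.
  have -> : K *m a = delta^-1 *: a.
    by rewrite -[in RHS]Ka scalerA mulVf ?scale1r// gt_eqF.
  by rewrite -scalemxAr linearZ/= mxtrace_sqnorm2.
have -> : \tr (K *m K) - 2 * c * (delta^-1 * sqnorm2 a) + c ^+ 2 * sqnorm2 a ^+ 2 =
    \tr (K *m K) - delta^-1 ^+ 2.
  by rewrite /c; field; rewrite a0 gt_eqF.
rewrite subr_ge0 => /(ler_wpM2l (sqr_ge0 delta)).
by rewrite -exprMn mulfV ?gt_eqF// expr1n expr2 mulrA.
Qed.

End positive.

(** The unregularized resolvent dominates all the regularized ones. *)
Section limit.
Variables (delta : R) (M : 'M[R]_(m, n)).
Hypotheses (delta0 : 0 < delta) (nonsing : \det (gram A (reg 0 M)) != 0).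
Local Notation K := (Kreg delta M).
Local Notation K0 := (Kreg 0 M).
Let d0 := det_reg M delta0.

Lemma quad_K0 (v : 'cV[R]_n) : (v^T *m K0 *m v) 0 0 = sqnorm2 (M *m (K0 *m v)).
Proof.
have := quad_reg 0 M (K0 *m v); rewrite mul0r addr0 => <-.
have := resolventK nonsing; rewrite -/(Kreg 0 M).
move: (K0) (trmx_Kreg 0 M) => k kT E.
by rewrite -[in LHS]E trmx_mul kT !mulmxA.
Qed.

(** The resolvent identity, from which the comparisons below follow since the
    unregularized resolvent is a positive form. *)
Lemma K0B : K0 = K + delta *: (K0 *m K).
Proof.
apply/eqP; rewrite addrC -subr_eq; apply/eqP.
rewrite [LHS]resolventB//.
have -> : reg delta M - reg 0 M = delta%:M.
  by rewrite /reg opprD addrACA subrr add0r raddf0 subr0.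
by rewrite mul_mx_scalar -scalemxAl.
Qed.

Lemma sqnorm2_Kreg_le (v : 'cV[R]_n) : sqnorm2 (K *m v) <= sqnorm2 (K0 *m v).
Proof.
have -> : K0 *m v = K *m v + delta *: (K0 *m (K *m v)).
  by rewrite [in LHS]K0B mulmxDl -scalemxAl -mulmxA.
set y := K *m v; rewrite sqnorm2D -addrA lerDl.
have -> : (y^T *m (delta *: (K0 *m y))) 0 0 = delta * (y^T *m K0 *m y) 0 0.
  by rewrite -scalemxAr [LHS]mxE mulmxA.
rewrite quad_K0 addr_ge0 ?sqnorm2_ge0// mulr_ge0// mulr_ge0 ?sqnorm2_ge0//.
exact: ltW.
Qed.

Lemma tr_Kreg_le0 : \tr K <= \tr K0.
Proof.
rewrite -subr_ge0 [in X in _ <= X]K0B linearD/= addrAC subrr add0r linearZ/=.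
rewrite mulr_ge0 ?(ltW delta0)// [in X in _ <= X]K0B mulmxDl linearD/=.
rewrite addr_ge0 ?tr_KregK_ge0// -scalemxAl linearZ/= mulr_ge0 ?(ltW delta0)//.
rewrite -mulmxA mxtrace_mulC -mulmxA mxtrace_mulC.
have := resolventK nonsing; rewrite -/(Kreg 0 M).
have := trmx_Kreg delta M; have := trmx_Kreg 0 M.
move: (K) (K0) => k k0 k0T kT E; rewrite -[in X in _ <= X]E /reg raddf0 addr0.
have -> : k *m (k0 *m (M^T *m M) *m k0) *m k = (M *m k0 *m k)^T *m (M *m k0 *m k).
  by rewrite !trmx_mul k0T kT !mulmxA.
exact: tr_gram_ge0.
Qed.

Lemma Kreg_cvg_bound i j : `|K0 i j - K i j| <=
  delta * \sum_k `|K0 i k| * (1 + \sum_l K0 l j ^+ 2).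
Proof.
rewrite {1}K0B mxE addrAC subrr add0r mxE normrM gtr0_norm// ler_pM2l// mxE.
apply: (le_trans (ler_norm_sum _ _ _)); apply: ler_sum => k _.
rewrite normrM ler_wpM2l//.
have Kkj : `|K k j| ^+ 2 <= \sum_l K0 l j ^+ 2.
  rewrite real_normK ?num_real//.
  have := sqnorm2_Kreg_le (delta_mx j 0); rewrite -!colE /sqnorm2.
  rewrite (eq_bigr (fun l => K l j ^+ 2)) => [|l _]; last by rewrite [col _ _ _ _]mxE.
  rewrite [leRHS](eq_bigr (fun l => K0 l j ^+ 2)) => [|l _]; last by rewrite [col _ _ _ _]mxE.
  by apply: le_trans; rewrite (bigD1 k)//= lerDl sumr_ge0// => l _; rewrite sqr_ge0.
have := normr_ge0 (K k j); move: (`|K k j|) Kkj => x; nra.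
Qed.

End limit.
End regularized.

(** * Smoothness of the regularized resolvent *)

Section borel_matrix.
Variables (R : realType) (m n : nat).
Local Notation mx := 'M[R]_(m, n).

Definition mborel p q (F : mx -> 'M[R]_(p, q)) := forall a b, borel (fun M => F M a b).

Lemma mborel_id : mborel id.
Proof. by move=> a b disp T F mF; exact: mF. Qed.

Lemma mborel_cst p q (B : 'M[R]_(p, q)) : mborel (fun=> B).
Proof. by move=> a b disp T F mF; exact: measurable_cst. Qed.

Lemma mborelD p q (F G : mx -> 'M[R]_(p, q)) : mborel F -> mborel G ->
  mborel (fun M => F M + G M).
Proof.
move=> bF bG a b disp T H mH; under eq_fun do rewrite mxE.
by apply: measurable_funD; [exact: bF|exact: bG].
Qed.

Lemma mborel_mul p q r (F : mx -> 'M[R]_(p, q)) (G : mx -> 'M[R]_(q, r)) :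
  mborel F -> mborel G -> mborel (fun M => F M *m G M).
Proof.
move=> bF bG a b disp T H mH; under eq_fun do rewrite mxE.
by apply: measurable_sum => c; apply: measurable_funM; [exact: bF|exact: bG].
Qed.

Lemma mborel_tr p q (F : mx -> 'M[R]_(p, q)) : mborel F -> mborel (fun M => (F M)^T).
Proof.
by move=> bF a b disp T H mH; under eq_fun do rewrite mxE; exact: bF.
Qed.

Lemma borel_det p (F : mx -> 'M[R]_p) : mborel F -> borel (fun M => \det (F M)).
Proof.
move=> bF disp T H mH; rewrite /determinant; apply: measurable_sum => s.
apply: measurable_funM; first exact: measurable_cst.
by apply: measurable_prod => i _; exact: bF.
Qed.

Lemma mborel_adjinv p (F : mx -> 'M[R]_p) : mborel F ->
  mborel (fun M => adjinv (F M)).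
Proof.
move=> bF a b disp T H mH; rewrite /adjinv; under eq_fun do rewrite !mxE.
apply: measurable_funM.
  by apply: (measurableT_comp (@measurable_inv R)); exact: borel_det.
apply: measurable_funM; first exact: measurable_cst.
apply: (@borel_det _ (fun M => row' b (col' a (F M)))) => // i j disp' T' H' mH'.
by under eq_fun do rewrite !mxE; exact: bF.
Qed.

Lemma mborel_Kreg d (A : 'M[R]_(n, d)) delta : mborel (@Kreg R m n d A delta).
Proof.
apply: mborel_mul; last exact: mborel_cst.
apply: mborel_mul; first exact: mborel_cst.
apply: mborel_adjinv; apply: mborel_mul; last exact: mborel_cst.
apply: mborel_mul; first exact: mborel_cst.
apply: mborelD; last exact: mborel_cst.
by apply: mborel_mul; [apply: mborel_tr|]; exact: mborel_id.
Qed.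

End borel_matrix.

Lemma cvg_bigsum (R : realType) (U : Type) (F : set_system U) (FF : Filter F)
    (I : Type) (s : seq I) (f : I -> U -> R) (l : I -> R) :
  (forall i, f i x @[x --> F] --> l i) ->
  (\sum_(i <- s) f i x) @[x --> F] --> \sum_(i <- s) l i.
Proof.
move=> fl; elim: s => [|i s IH].
  by under eq_fun do rewrite big_nil; rewrite big_nil; exact: cvg_cst.
by under eq_fun do rewrite big_cons; rewrite big_cons; exact: cvgD.
Qed.

Section Kreg_line.
Variables (R : realType) (m n d : nat) (A : 'M[R]_(n, d)).
Hypothesis A_inj : forall v : 'cV[R]_d, A *m v = 0 -> v = 0.
Variable delta : R.
Hypothesis delta0 : 0 < delta.
Implicit Types (M E : 'M[R]_(m, n)).
Local Notation K := (Kreg A delta).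

Let Q M E h := (E^T *m M + M^T *m E) + h *: (E^T *m E).

(** The resolvent identity makes the difference quotient explicit. *)
Let Kreg_diff M E h : K (M + h *: E) = K M - h *: (K (M + h *: E) *m Q M E h *m K M).
Proof.
rewrite -[LHS](subrK (K M)) addrC; congr (_ + _).
rewrite [LHS]resolventB ?det_reg//.
have -> : reg delta M - reg delta (M + h *: E) = - (h *: Q M E h).
  rewrite /reg /Q opprD addrACA subrr addr0 [(M + h *: E)^T]linearD/=.
  rewrite [(h *: E)^T]linearZ/= mulmxDl !mulmxDr.
  rewrite -!(scalemxAl, scalemxAr) !scalerDr.
  move: (M^T *m M) (M^T *m E) (E^T *m M) (E^T *m E) => a b c e.
  by apply/matrixP => i j; rewrite !mxE; ring.
by rewrite mulmxN mulNmx -scalemxAr -scalemxAl.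
Qed.

Let Kreg_line_cvg M E a b : (K (M + h *: E)) a b @[h --> (0 : R)] --> K M a b.
Proof.
pose C := \sum_c \sum_e
  delta^-1 * (`|(E^T *m M + M^T *m E) e c| + `|(E^T *m E) e c|) * delta^-1.
suff H : `|(K (M + h *: E)) a b - K M a b| @[h --> (0 : R)] --> (0 : R).
  exact: (cvg_zero (norm_cvg0 H)).
refine (@squeeze_cvgr _ (nbhs (0 : R)) _ R (fun=> 0) (fun h => `|h| * C) _ _ 0 _ _).
- near=> h.
  have h1 : `|h| <= 1.
    near: h; exists 1 => //= y; rewrite /ball_ /= sub0r normrN => /ltW.
    exact.
  rewrite normr_ge0/=.
  rewrite {1}Kreg_diff !mxE addrAC subrr add0r normrN normrM ler_wpM2l//.
  apply: (le_trans (ler_norm_sum _ _ _)); apply: ler_sum => c _.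
  rewrite mxE mulr_suml; apply: (le_trans (ler_norm_sum _ _ _)).
  apply: ler_sum => e _; rewrite !normrM.
  apply: ler_pM; rewrite ?mulr_ge0 ?Kreg_le//.
  apply: ler_pM; rewrite ?Kreg_le//.
  rewrite /Q [X in `|X|]mxE; apply: (le_trans (ler_normD _ _)); rewrite lerD2l.
  by rewrite [X in `|X|]mxE normrM ler_piMl.
- exact: cvg_cst.
- rewrite -[X in _ --> X](mul0r C) -[X in X * C](@normr0 _ R).
  by apply: cvgM; [apply: cvg_norm; exact: cvg_id|exact: cvg_cst].
Unshelve. all: by end_near.
Qed.

(** The derivative of M |-> K M in the direction E. *)
Definition DKreg M E := - (K M *m (E^T *m M + M^T *m E) *m K M).

Lemma is_derive_Kreg M E (x : R) a b :
  is_derive x 1 (fun y : R => K (M + y *: E) a b) (DKreg (M + x *: E) E a b).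
Proof.
set N := M + x *: E.
have Qcvg e c : Q N E h e c @[h --> (0 : R)] --> (E^T *m N + N^T *m E) e c.
  have -> : (fun h => Q N E h e c) =
      (fun h => (E^T *m N + N^T *m E) e c + h * (E^T *m E) e c).
    by apply/funext => h; rewrite /Q mxE [X in _ + X]mxE.
  have -> : (E^T *m N + N^T *m E) e c =
      (E^T *m N + N^T *m E) e c + 0 * (E^T *m E) e c by rewrite mul0r addr0.
  apply: cvgD; first by rewrite mul0r addr0; exact: cvg_cst.
  by apply: cvgM; [exact: cvg_id|exact: cvg_cst].
have main : (K (N + h *: E) *m Q N E h *m K N) a b @[h --> (0 : R)] -->
    (K N *m (E^T *m N + N^T *m E) *m K N) a b.
  have KQ c : (K (N + h *: E) *m Q N E h) a c @[h --> (0 : R)] -->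
      (K N *m (E^T *m N + N^T *m E)) a c.
    have -> : (fun h => (K (N + h *: E) *m Q N E h) a c) =
        (fun h => \sum_e K (N + h *: E) a e * Q N E h e c).
      by apply/funext => h; rewrite mxE.
    rewrite mxE; apply: cvg_bigsum => e.
    by apply: cvgM; [exact: Kreg_line_cvg|exact: Qcvg].
  have -> : (fun h => (K (N + h *: E) *m Q N E h *m K N) a b) =
      (fun h => \sum_c (K (N + h *: E) *m Q N E h) a c * K N c b).
    by apply/funext => h; rewrite mxE.
  rewrite mxE; apply: cvg_bigsum => c.
  by apply: cvgM; [exact: KQ|exact: cvg_cst].
have : (fun h : R => h^-1 *: (((fun y : R => K (M + y *: E) a b) \o shift x) (h *: 1)
    - K (M + x *: E) a b)) @ 0^' --> DKreg N E a b.
  apply: (@cvg_trans _ ((fun h => - (K (N + h *: E) *m Q N E h *m K N) a b) @ 0^')).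
    apply: near_eq_cvg; near=> h.
    have h0 : h != 0 by near: h; exact: nbhs_dnbhs_neq.
    rewrite /= -/N.
    have -> : M + (h *: (1 : R) + x) *: E = N + h *: E.
      by rewrite scalerDl /N addrAC addrA /GRing.scale/= mulr1.
    rewrite {2}Kreg_diff; move: (_ *m K N) => X.
    move: (K N) => k; rewrite !mxE addrAC subrr add0r.
    by rewrite /GRing.scale/= mulrN mulKf.
  have -> : DKreg N E a b = - (K N *m (E^T *m N + N^T *m E) *m K N) a b by rewrite mxE.
  exact: cvg_within_filter (cvgN main).
move=> l; apply: DeriveDef; first by apply/cvg_ex; eexists; exact: l.
exact: cvg_lim l.
Unshelve. all: by end_near.
Qed.

Lemma tame_Kreg a b : tame (fun M => K M a b).
Proof.
split=> [|M E x|]; first exact: mborel_Kreg.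
  apply: differentiable_continuous; apply/derivable1_diffP.
  by have [] := is_derive_Kreg M E x a b.
by exists delta^-1, 0%N => M; rewrite mul0r expR0 mulr1 Kreg_le.
Qed.

End Kreg_line.

(** * Matrix calculus for smooth functions *)

Section calculus.
Variables (R : realType) (m n : nat).
Local Notation mx := 'M[R]_(m, n).
Implicit Types (g h : mx -> R) (Dg Dh : mx -> mx -> R).

Lemma tame_eq g h : tame g -> g =1 h -> tame h.
Proof. by move=> tg /funext <-. Qed.

Lemma smooth_eq g h Dg Dh : smooth g Dg -> g =1 h -> Dg =2 Dh -> smooth h Dh.
Proof.
move=> sg /funext <- DgE; rewrite (_ : Dh = Dg)//.
by apply/funext => M; apply/funext => E; rewrite DgE.
Qed.

Lemma smooth_cst (c : R) : smooth (fun _ : mx => c) (fun _ _ => 0).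
Proof.
split=> [|E|M E x]; [exact: tame_cst|exact: tame_cst|exact: is_derive_cst].
Qed.

Lemma smooth_entry i j : smooth (fun M : mx => M i j) (fun _ E => E i j).
Proof.
split=> [|E|M E x]; [exact: tame_entry|exact: tame_cst|].
rewrite (_ : (fun y : R => _) = (fun y : R => M i j + y * E i j)); last first.
  by apply/funext => y; rewrite !mxE.
by apply: is_derive_eq; rewrite /GRing.scale/=; ring.
Qed.

Lemma smoothD g h Dg Dh : smooth g Dg -> smooth h Dh ->
  smooth (fun M => g M + h M) (fun M E => Dg M E + Dh M E).
Proof.
move=> [tg tDg dg] [th tDh dh]; split=> [|E|M E x].
- exact: tameD.
- exact: tameD.
have := dg M E x; have := dh M E x => ? ?.
exact: is_deriveD.
Qed.

Lemma smoothM g h Dg Dh : smooth g Dg -> smooth h Dh ->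
  smooth (fun M => g M * h M) (fun M E => Dg M E * h M + g M * Dh M E).
Proof.
move=> [tg tDg dg] [th tDh dh]; split=> [|E|M E x].
- exact: tameM.
- by apply: tameD; exact: tameM.
have := dg M E x; have := dh M E x => ? ?.
by apply: is_derive_eq; rewrite /GRing.scale/=; ring.
Qed.

Lemma smooth_sum (I : Type) (s : seq I) (g : I -> mx -> R)
    (Dg : I -> mx -> mx -> R) :
  (forall i, smooth (g i) (Dg i)) ->
  smooth (fun M => \sum_(i <- s) g i M) (fun M E => \sum_(i <- s) Dg i M E).
Proof.
move=> sg; elim: s => [|i s IH].
  by apply: (smooth_eq (smooth_cst 0)) => [M|M E]; rewrite big_nil.
by apply: (smooth_eq (smoothD (sg i) IH)) => [M|M E]; rewrite big_cons.
Qed.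

Definition mtame p q (F : mx -> 'M[R]_(p, q)) := forall a b, tame (fun M => F M a b).

Definition msmooth p q (F : mx -> 'M[R]_(p, q)) (DF : mx -> mx -> 'M[R]_(p, q)) :=
  forall a b, smooth (fun M => F M a b) (fun M E => DF M E a b).

Lemma msmooth_tame p q (F : mx -> 'M[R]_(p, q)) DF : msmooth F DF -> mtame F.
Proof. by move=> sF a b; have [] := sF a b. Qed.

Lemma msmooth_cst p q (B : 'M[R]_(p, q)) : msmooth (fun=> B) (fun _ _ => 0).
Proof. by move=> a b; apply: (smooth_eq (smooth_cst (B a b))) => // M E; rewrite mxE. Qed.

Lemma msmooth_id : msmooth id (fun _ E => E).
Proof. exact: smooth_entry. Qed.

Lemma msmooth_tr p q (F : mx -> 'M[R]_(p, q)) DF : msmooth F DF ->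
  msmooth (fun M => (F M)^T) (fun M E => (DF M E)^T).
Proof.
by move=> sF a b; apply: (smooth_eq (sF b a)) => [M|M E]; rewrite mxE.
Qed.

Lemma msmooth_mul p q r (F : mx -> 'M[R]_(p, q)) (G : mx -> 'M[R]_(q, r)) DF DG :
  msmooth F DF -> msmooth G DG ->
  msmooth (fun M => F M *m G M) (fun M E => DF M E *m G M + F M *m DG M E).
Proof.
move=> sF sG a b.
apply: (smooth_eq (smooth_sum (index_enum 'I_q) (fun c => smoothM (sF a c) (sG c b)))).
  by move=> M; rewrite mxE.
by move=> M E; rewrite !mxE big_split.
Qed.

Lemma mtame_mul p q r (F : mx -> 'M[R]_(p, q)) (G : mx -> 'M[R]_(q, r)) :
  mtame F -> mtame G -> mtame (fun M => F M *m G M).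
Proof.
move=> tF tG a b.
apply: (tame_eq (tame_sum (index_enum 'I_q) (fun c => tameM (tF a c) (tG c b)))).
by move=> M; rewrite mxE.
Qed.

Lemma mtame_tr p q (F : mx -> 'M[R]_(p, q)) : mtame F -> mtame (fun M => (F M)^T).
Proof. by move=> tF a b; apply: (tame_eq (tF b a)) => M; rewrite mxE. Qed.

Lemma mtameD p q (F G : mx -> 'M[R]_(p, q)) : mtame F -> mtame G ->
  mtame (fun M => F M + G M).
Proof. by move=> tF tG a b; apply: (tame_eq (tameD (tF a b) (tG a b))) => M; rewrite mxE. Qed.

Lemma mtame_cst p q (B : 'M[R]_(p, q)) : mtame (fun=> B).
Proof. by move=> a b; exact: tame_cst. Qed.

Lemma mtame_id : mtame id.
Proof. by move=> a b; exact: tame_entry. Qed.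

Lemma mtame_trace p (F : mx -> 'M[R]_p) : mtame F -> tame (fun M => \tr (F M)).
Proof. by move=> tF; apply: tame_sum => i; exact: tF. Qed.

Section resolvent.
Variables (d : nat) (A : 'M[R]_(n, d)).
Hypothesis A_inj : forall v : 'cV[R]_d, A *m v = 0 -> v = 0.
Variable delta : R.
Hypothesis delta0 : 0 < delta.

Lemma mtame_Kreg : mtame (@Kreg R m n d A delta).
Proof. by move=> a b; exact: tame_Kreg. Qed.

Lemma msmooth_Kreg : msmooth (@Kreg R m n d A delta) (DKreg A delta).
Proof.
move=> a b; split=> [|E|M E x]; [exact: mtame_Kreg| |exact: is_derive_Kreg].
have tK := mtame_Kreg; have tid := mtame_id; have tE p q B := @mtame_cst p q B.
have t : mtame (fun M : mx => Kreg A delta M *m (E^T *m M + M^T *m E) *m Kreg A delta M).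
  apply: mtame_mul => //; apply: mtame_mul => //; apply: mtameD; apply: mtame_mul => //.
  exact: mtame_tr.
by apply: (tame_eq (tameN (t a b))) => M; rewrite /DKreg [RHS]mxE.
Qed.

End resolvent.
End calculus.

(** * Exact identities for the regularized problem *)

Lemma delta_mxE (R : realType) m n p q (X : 'M[R]_(p, m)) (Y : 'M[R]_(n, q)) i j a b :
  (X *m delta_mx i j *m Y) a b = X a i * Y j b.
Proof.
rewrite mxE (bigD1 j)//= big1 ?addr0 => [|k kj].
  rewrite mxE (bigD1 i)//= big1 ?addr0 => [|k ki]; first by rewrite mxE !eqxx mulr1.
  by rewrite mxE (negbTE ki) mulr0.
rewrite mxE big1 ?mul0r// => l _.
by rewrite mxE (negbTE kj) andbF mulr0.
Qed.

Lemma sum_delta (R : realType) m n (X : 'M[R]_m) (Y : 'M[R]_n) :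
  \sum_i \sum_j (X *m delta_mx i j *m Y) i j = \tr X * \tr Y.
Proof.
rewrite /mxtrace mulr_suml; apply: eq_bigr => i _; rewrite mulr_sumr.
by apply: eq_bigr => j _; rewrite delta_mxE.
Qed.

Lemma sum_deltaT (R : realType) m n (X Y : 'M[R]_(m, n)) :
  \sum_i \sum_j (X *m (delta_mx i j)^T *m Y) i j = \tr (X^T *m Y).
Proof.
rewrite exchange_big; apply: eq_bigr => j _; rewrite mxE; apply: eq_bigr => i _.
by rewrite trmx_delta delta_mxE mxE.
Qed.

Section identities.
Variables (R : realType) (m n d : nat) (A : 'M[R]_(n, d)).
Hypothesis A_inj : forall v : 'cV[R]_d, A *m v = 0 -> v = 0.
Variables (disp : measure_display) (T : measurableType disp).
Variables (P : probability T R) (S : rmatrix P m n).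
Hypotheses (m0 : (0 < m)%N) (gS : gaussian_sketch S).
Local Notation mx := 'M[R]_(m, n).
Local Notation Sw := (rmatrix_val S).
Local Notation EX g := (\int[P]_w (g : mx -> R) (Sw w)).

Lemma EX_cst (c : R) : EX (fun=> c) = c.
Proof.
rewrite Rintegral_cst//.
have /= -> := probability_setT P.
by rewrite mulr1.
Qed.

Lemma EXD g h : tame g -> tame h -> EX (fun M => g M + h M) = EX g + EX h.
Proof.
by move=> tg th; apply: RintegralD => //; exact: (tame_integrable m0 gS).
Qed.

Lemma EXB g h : tame g -> tame h -> EX (fun M => g M - h M) = EX g - EX h.
Proof.
by move=> tg th; apply: RintegralB => //; exact: (tame_integrable m0 gS).
Qed.

Lemma EXZ (c : R) g : tame g -> EX (fun M => c * g M) = c * EX g.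
Proof. by move=> tg; apply: RintegralZl => //; exact: (tame_integrable m0 gS). Qed.

Lemma EX_sum (I : Type) (s : seq I) (g : I -> mx -> R) : (forall i, tame (g i)) ->
  EX (fun M => \sum_(i <- s) g i M) = \sum_(i <- s) EX (g i).
Proof.
move=> tg; elim: s => [|i s IH].
  by rewrite big_nil -[RHS](EX_cst 0); apply: eq_Rintegral => w _; rewrite big_nil.
rewrite big_cons -IH; apply: etrans (EXD (tg i) (tame_sum s tg)).
by apply: eq_Rintegral => w _; rewrite big_cons.
Qed.

(** The right-hand side is the divergence of [F]. *)
Lemma stein_trace (F : mx -> mx) DF : msmooth F DF ->
  EX (fun M => \tr (M^T *m F M)) =
  m%:R^-1 * EX (fun M => \sum_i \sum_j DF M (delta_mx i j) i j).
Proof.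
move=> sF; have tF := msmooth_tame sF.
have tD i j : tame (fun M => DF M (delta_mx i j) i j).
  by have [_ + _] := sF i j; exact.
have tSF i j : tame (fun M : mx => M i j * F M i j).
  by apply: tameM; [exact: tame_entry|exact: tF].
transitivity (EX (fun M => \sum_i \sum_j M i j * F M i j)).
  apply: eq_Rintegral => w _; rewrite [RHS]exchange_big; apply: eq_bigr => j _.
  by rewrite mxE; apply: eq_bigr => i _; rewrite mxE.
rewrite (EX_sum _ (fun i => tame_sum _ (tSF i))).
rewrite (EX_sum _ (fun i => tame_sum _ (tD i))).
rewrite mulr_sumr; apply: eq_bigr => i _.
rewrite (EX_sum _ (tSF i)) (EX_sum _ (tD i)) mulr_sumr; apply: eq_bigr => j _.
rewrite -(matrix_stein m0 gS i j (sF i j)); apply: eq_Rintegral => w _.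
by rewrite mxE.
Qed.

Variable delta : R.
Hypothesis delta0 : 0 < delta.
Local Notation K := (Kreg A delta).
Local Notation t1 M := (\tr (K M)).
Local Notation t2 M := (\tr (K M *m K M)).

Let sK := @msmooth_Kreg R m n d A A_inj delta delta0.
Let tK := @mtame_Kreg R m n d A A_inj delta delta0.
Let sid := @msmooth_id R m n.

Lemma tame_t1 : tame (fun M : mx => t1 M).
Proof. exact: mtame_trace. Qed.

Lemma tame_t2 : tame (fun M : mx => t2 M).
Proof. by apply: mtame_trace; exact: mtame_mul. Qed.

(** Integration by parts for M |-> M K: the left-hand side is
    d - delta tr K, and the divergence is a polynomial in tr K and tr K^2. *)
Lemma expect_trace :
  EX (fun M => (m%:R - d%:R - 1) * t1 M + delta * (m%:R * t1 M + t2 M + t1 M ^+ 2)) =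
  m%:R * d%:R.
Proof.
pose L (M : mx) := \tr (M^T *m (M *m K M)).
pose D (M : mx) := \sum_i \sum_j
  (delta_mx i j *m K M + M *m DKreg A delta M (delta_mx i j)) i j.
have LD : EX L = m%:R^-1 * EX D := stein_trace (msmooth_mul sid sK).
have LE M : L M = d%:R - delta * t1 M.
  by rewrite /L mulmxA mxtrace_mulC -[RHS](tr_KregN A_inj M delta0).
have DE M : D M = m%:R * t1 M - (t1 M - delta * t2 M) - (d%:R - delta * t1 M) * t1 M.
  rewrite /D.
  have E i j : (delta_mx i j *m K M + M *m DKreg A delta M (delta_mx i j)) i j =
      (1%:M *m delta_mx i j *m K M) i j -
      ((M *m K M) *m (delta_mx i j)^T *m (M *m K M)) i j -
      ((M *m K M *m M^T) *m delta_mx i j *m K M) i j.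
    rewrite /DKreg mulmxDr mulmxDl mulmxN mulmxDr !mulmxA mul1mx.
    by rewrite opprD addrA [LHS]mxE [X in X + _]mxE [X in _ + X + _]mxE [X in _ + X]mxE.
  under eq_bigr do (under eq_bigr do rewrite E; rewrite !big_split /= !sumrN).
  rewrite !big_split /= !sumrN sum_delta sum_deltaT sum_delta mxtrace1.
  rewrite -(tr_KregNK A_inj M delta0) -(tr_KregN A_inj M delta0).
  congr (_ - \tr _ - _ * _); first by rewrite trmx_mul trmx_Kreg !mulmxA.
  by move: (K M) => k; rewrite mulmxA [RHS]mxtrace_mulC mulmxA.
have tt1 := tame_t1; have tt2 := tame_t2.
have tL : tame L.
  apply: (tame_eq (tameB (tame_cst m n d%:R) (tameM (tame_cst m n delta) tt1))) => M.
  by rewrite LE.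
have tD : tame D.
  apply: (tame_eq (tameB (tameB (tameM (tame_cst m n m%:R) tt1)
    (tameB tt1 (tameM (tame_cst m n delta) tt2))) (tameM tL tt1))) => M.
  by rewrite DE LE.
have mN0 : m%:R != 0 :> R by rewrite pnatr_eq0 -lt0n.
transitivity (EX (fun M => m%:R * d%:R - (m%:R * L M - D M))).
  by apply: eq_Rintegral => w _; rewrite LE DE; ring.
have tmL : tame (fun M => m%:R * L M) by apply: tameM => //; exact: tame_cst.
have e1 : EX (fun M => m%:R * d%:R - (m%:R * L M - D M)) =
    EX (fun=> m%:R * d%:R) - EX (fun M => m%:R * L M - D M).
  exact: (EXB (tame_cst m n (m%:R * d%:R)) (tameB tmL tD)).
have e2 : EX (fun M => m%:R * L M - D M) = EX (fun M => m%:R * L M) - EX D.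
  exact: (EXB tmL tD).
have e3 : EX (fun M => m%:R * L M) = m%:R * EX L by exact: (EXZ _ tL).
by rewrite e1 e2 e3 LD EX_cst mulVKf// subrr subr0.
Qed.

Section residual.
Variable b : 'cV[R]_n.
Hypothesis Ab : A^T *m b = 0.

Let bK (M : mx) : b^T *m K M = 0.
Proof.
by rewrite -[LHS]trmxK trmx_mul trmxK trmx_Kreg resolvent_ker// trmx0.
Qed.

(** How the terms of the divergences vanish. *)
Let tr_ker q (k : 'M[R]_n) (X : 'M[R]_(n, q)) (c : 'cV[R]_q) : b^T *m k = 0 ->
  \tr (k *m X *m (c *m b^T)) = 0.
Proof.
move=> bk; rewrite mulmxA mxtrace_mulC !mulmxA bk.
by rewrite !mul0mx /mxtrace big_ord1 mxE.
Qed.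

(** Integration by parts for M |-> M K K M^T M b b^T, whose contraction with M
    is the squared norm. As K b = 0, a term of the divergence survives only if
    the derivative falls on the last M, next to b. *)
Lemma expect_sqnorm2 :
  EX (fun M => sqnorm2 (K M *m (M^T *m (M *m b)))) =
  m%:R^-1 * sqnorm2 b * EX (fun M => t1 M - delta * t2 M).
Proof.
have sbb := @msmooth_cst R m n n n (b *m b^T).
pose L (M : mx) := \tr (M^T *m (M *m K M *m K M *m M^T *m M *m (b *m b^T))).
pose D (M : mx) := \sum_i \sum_j
  (((((delta_mx i j *m K M + M *m DKreg A delta M (delta_mx i j)) *m K M
     + M *m K M *m DKreg A delta M (delta_mx i j)) *m M^T
     + M *m K M *m K M *m (delta_mx i j)^T) *m M
     + M *m K M *m K M *m M^T *m delta_mx i j) *m (b *m b^T)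
     + M *m K M *m K M *m M^T *m M *m 0) i j.
have LD : EX L = m%:R^-1 * EX D.
  exact: (stein_trace (msmooth_mul (msmooth_mul (msmooth_mul (msmooth_mul
    (msmooth_mul sid sK) sK) (msmooth_tr sid)) sid) sbb)).
have LE M : L M = sqnorm2 (K M *m (M^T *m (M *m b))).
  rewrite /L; move: (K M) (trmx_Kreg A delta M) => k kT.
  rewrite sqnorm2E !trmx_mul trmxK kT !mulmxA mxtrace_mulC /mxtrace big_ord1.
  by rewrite !mulmxA.
have DE M : D M = sqnorm2 b * (t1 M - delta * t2 M).
  rewrite /D -(tr_KregNK A_inj M delta0) /DKreg.
  move: (K M) (trmx_Kreg A delta M) (bK M) => k kT bk; set Bb := b *m b^T.
  have E i j : (((((delta_mx i j *m k
     + M *m - (k *m ((delta_mx i j)^T *m M + M^T *m delta_mx i j) *m k)) *m k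
     + M *m k *m - (k *m ((delta_mx i j)^T *m M + M^T *m delta_mx i j) *m k)) *m M^T
     + M *m k *m k *m (delta_mx i j)^T) *m M
     + M *m k *m k *m M^T *m delta_mx i j) *m Bb + M *m k *m k *m M^T *m M *m 0) i j =
     (1%:M *m delta_mx i j *m (k *m (k *m M^T *m M) *m Bb)) i j
   - ((M *m k) *m (delta_mx i j)^T *m (M *m k *m k *m M^T *m M *m Bb)) i j
   - ((M *m k *m M^T) *m delta_mx i j *m (k *m (k *m M^T *m M) *m Bb)) i j
   - ((M *m k *m k) *m (delta_mx i j)^T *m (M *m k *m M^T *m M *m Bb)) i j
   - ((M *m k *m k *m M^T) *m delta_mx i j *m (k *m (M^T *m M) *m Bb)) i j
   + ((M *m k *m k) *m (delta_mx i j)^T *m (M *m Bb)) i j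
   + ((M *m k *m k *m M^T) *m delta_mx i j *m Bb) i j.
    rewrite mulmx0 addr0; set e := delta_mx i j.
    have -> : forall X1 X2 X3 X4 X5 X6 X7 : mx, X1 i j - X2 i j - X3 i j - X4 i j - X5 i j
        + X6 i j + X7 i j = (X1 - X2 - X3 - X4 - X5 + X6 + X7) i j.
      by move=> *; rewrite !mxE.
    congr (fun X : mx => X i j).
    by rewrite !(mulmxN, mulmxDr, mulmxDl, mulNmx, mulmxA, mul1mx, opprD, addrA).
  under eq_bigr do (under eq_bigr do rewrite E; rewrite !big_split /= !sumrN).
  rewrite !big_split /= !sumrN !sum_delta !sum_deltaT.
  have h1 (Y : mx) : \tr ((M *m k)^T *m (Y *m Bb)) = 0.
    by rewrite trmx_mul kT -(tr_ker (M^T *m Y) b bk) !mulmxA.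
  have h2 (Y : mx) : \tr ((M *m k *m k)^T *m (Y *m Bb)) = 0.
    by rewrite !trmx_mul kT -(tr_ker (k *m M^T *m Y) b bk) !mulmxA.
  rewrite !h1 !h2 !(tr_ker _ _ bk) !mulr0 !subr0 !add0r.
  rewrite mulrC; congr (_ * _); first by rewrite /Bb mxtrace_mulC mxtrace_sqnorm2.
  have -> : M *m k *m k *m M^T = M *m (k *m k *m M^T) by rewrite !mulmxA.
  by rewrite mxtrace_mulC [RHS]mxtrace_mulC !mulmxA.
have tt : tame (fun M : mx => t1 M - delta * t2 M).
  exact: (tameB tame_t1 (tameM (tame_cst m n delta) tame_t2)).
transitivity (EX L); first by apply: eq_Rintegral => w _; rewrite LE.
rewrite LD -mulrA; congr (_ * _).
transitivity (EX (fun M => sqnorm2 b * (t1 M - delta * t2 M))); last exact: (EXZ _ tt).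
by apply: eq_Rintegral => w _; rewrite DE.
Qed.

(** The same for M |-> M K c b^T, with [c] the [a]-th basis vector; now no term
    survives. *)
Lemma expect_entry a : EX (fun M => (K M *m (M^T *m (M *m b))) a 0) = 0.
Proof.
pose c : 'cV[R]_n := delta_mx a 0.
have scb := @msmooth_cst R m n n n (c *m b^T).
pose L (M : mx) := \tr (M^T *m (M *m K M *m (c *m b^T))).
pose D (M : mx) := \sum_i \sum_j
  ((delta_mx i j *m K M + M *m DKreg A delta M (delta_mx i j)) *m (c *m b^T)
     + M *m K M *m 0) i j.
have LD : EX L = m%:R^-1 * EX D.
  exact: (stein_trace (msmooth_mul (msmooth_mul sid sK) scb)).
have LE M : L M = (K M *m (M^T *m (M *m b))) a 0.
  rewrite /L; move: (K M) (trmx_Kreg A delta M) => k kT.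
  rewrite !mulmxA mxtrace_mulC /mxtrace big_ord1.
  rewrite dotmxC !trmx_mul !trmxK kT -!mulmxA trmx_delta -rowE mxE.
  by [].
have DE M : D M = 0.
  rewrite /D /DKreg; move: (K M) (trmx_Kreg A delta M) (bK M) => k kT bk.
  set Bb := c *m b^T.
  have E i j : ((delta_mx i j *m k
     + M *m - (k *m ((delta_mx i j)^T *m M + M^T *m delta_mx i j) *m k)) *m Bb
     + M *m k *m 0) i j =
     (1%:M *m delta_mx i j *m (k *m 1%:M *m Bb)) i j
   - ((M *m k) *m (delta_mx i j)^T *m (M *m k *m Bb)) i j
   - ((M *m k *m M^T) *m delta_mx i j *m (k *m 1%:M *m Bb)) i j.
    rewrite mulmx0 addr0 mulmx1; set e := delta_mx i j.
    have -> : forall X1 X2 X3 : mx, X1 i j - X2 i j - X3 i j = (X1 - X2 - X3) i j.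
      by move=> *; rewrite !mxE.
    congr (fun X : mx => X i j).
    by rewrite !(mulmxN, mulmxDr, mulmxDl, mulNmx, mulmxA, mul1mx, opprD, addrA).
  under eq_bigr do (under eq_bigr do rewrite E; rewrite !big_split /= !sumrN).
  rewrite !big_split /= !sumrN !sum_delta !sum_deltaT.
  have -> : \tr ((M *m k)^T *m (M *m k *m Bb)) = 0.
    by rewrite trmx_mul kT -(tr_ker (M^T *m M *m k) c bk) !mulmxA.
  by rewrite !(tr_ker _ _ bk) !mulr0 !subr0.
transitivity (EX L); first by apply: eq_Rintegral => w _; rewrite LE.
rewrite LD (_ : EX D = 0) ?mulr0// -[RHS](EX_cst 0).
by apply: eq_Rintegral => w _; rewrite DE.
Qed.

End residual.
End identities.

(** * Letting the regularization vanish *)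

Lemma ae_imply d (T : measurableType d) (R : realType) (P : probability T R)
    (A B : T -> Prop) : (forall w, A w -> B w) ->
  {ae P, forall w, A w} -> {ae P, forall w, B w}.
Proof. by move=> AB; apply: (@filterS _ _ (ae_filter_ringOfSetsType P) _ _ AB). Qed.

(** Fatou's lemma makes the limit integrable; being dominated by a multiple of
    their own limit, the integrals then converge. *)
Lemma limit_integral d (T : measurableType d) (R : realType)
    (P : probability T R) (Q_ : nat -> T -> R) (Q : T -> R) (kappa c : R) :
  (forall r, measurable_fun setT (Q_ r)) -> measurable_fun setT Q ->
  {ae P, forall w, (forall r, 0 <= Q_ r w <= kappa * Q w) /\
                   Q_ ^~ w @ \oo --> Q w} ->
  (forall r, \int[P]_w (Q_ r w)%:E = c%:E)%E ->
  P.-integrable setT (EFin \o Q) /\ \int[P]_w Q w = c.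
Proof.
move=> mQ_ mQ aeQ intQ.
have mE_ r : measurable_fun setT (EFin \o Q_ r) by exact/measurable_EFinP.
have mE : measurable_fun setT (EFin \o Q) by exact/measurable_EFinP.
have ma_ r : measurable_fun setT (fun w => `|(Q_ r w)%:E|%E).
  exact: measurableT_comp (mE_ r).
have iQ : P.-integrable setT (EFin \o Q).
  apply/integrableP; split => //.
  apply: (@le_lt_trans _ _ c%:E); last by rewrite ltry.
  have -> : c%:E = limn_einf (fun r => \int[P]_w `|(Q_ r w)%:E|)%E.
    rewrite (_ : (fun r => _) = fun=> c%:E).
      apply/esym; rewrite is_cvg_limn_einfE; last by apply/cvg_ex; exists c%:E; exact: cvg_cst.
      by apply: cvg_lim => //; exact: cvg_cst.
    apply/funext => r; rewrite -(intQ r); apply: ae_eq_integral => //; first exact: mE_.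
    move: aeQ; apply: ae_imply => w [Qw _] _ /=.
    by have /andP[Q0 _] := Qw r; rewrite ger0_norm.
  have fat := @fatou _ _ _ P setT measurableT (fun r w => `|(Q_ r w)%:E|%E) ma_
    (fun r w _ => abse_ge0 _).
  apply: le_trans fat.
  rewrite le_eqVlt; apply/orP; left; apply/eqP; apply: ae_eq_integral => //.
  - exact: measurableT_comp mE.
  - apply: measurableT_comp => //; apply: measurable_fun_limn_esup => r.
    by apply: measurableT_comp => //; exact: ma_.
  - move: aeQ; apply: ae_imply => w [_ Qw] _ /=.
    have c1 : (fun r => `|(Q_ r w)%:E|%E) @ \oo --> `|(Q w)%:E|%E.
      by apply: cvg_abse; apply: cvg_EFin; [exact: nearW|exact: Qw].
    rewrite is_cvg_limn_einfE; last by apply/cvg_ex; eexists; exact: c1.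
    by apply/esym/cvg_lim.
split=> //.
have [_ _ cv] : [/\ P.-integrable setT (EFin \o Q),
    (fun r => \int[P]_w `|(Q_ r w)%:E - (Q w)%:E|)%E @ \oo --> 0%E &
    (fun r => \int[P]_w (Q_ r w)%:E)%E @ \oo --> (\int[P]_w (Q w)%:E)%E].
  apply: (@dominated_convergence _ _ R P setT measurableT
    (fun r w => (Q_ r w)%:E) (EFin \o Q) (fun w => kappa%:E * (Q w)%:E)%E) => //.
  - move: aeQ; apply: ae_imply => w [_ Qw] _ /=.
    by apply: cvg_EFin; [exact: nearW|exact: Qw].
  - exact: integrableZl.
  - move: aeQ; apply: ae_imply => w [Qw _] r _ /=.
    by rewrite lee_fin; have /andP[Q0 Qk] := Qw r; rewrite ger0_norm.
have -> : \int[P]_w Q w = fine (c%:E); last by [].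
congr fine; apply: (cvg_unique _ cv) => //.
by rewrite (_ : (fun r => _) = fun=> c%:E); [exact: cvg_cst|apply/funext].
Qed.

Lemma cvg_sqr (R : realType) (f : nat -> R) (l : R) :
  f @ \oo --> l -> f r ^+ 2 @[r --> \oo] --> l ^+ 2.
Proof.
by move=> fl; rewrite expr2; under eq_fun do rewrite expr2; exact: cvgM.
Qed.

(** The regularized trace identity is dominated by the unregularized trace. *)
Lemma regularized_trace_bound (R : realType) (M D x y z e : R) :
  0 <= M -> 0 < M - D - 1 -> 0 <= x -> 0 <= y -> e * y <= x -> e * x <= D ->
  x <= z -> 0 < e -> e <= 1 -> 0 <= D ->
  0 <= (M - D - 1) * x + e * (M * x + y + x ^+ 2) <=
    2 * M / (M - D - 1) * ((M - D - 1) * z).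
Proof.
move=> M0 dof x0 y0 ey ex xz e0 e1 D0.
have -> : 2 * M / (M - D - 1) * ((M - D - 1) * z) = 2 * M * z.
  by field; rewrite gt_eqF.
apply/andP; split.
  apply: addr_ge0; apply: mulr_ge0 => //; try exact: ltW.
  by rewrite !addr_ge0 ?mulr_ge0 ?sqr_ge0.
have h1 : (M - D - 1) * x <= (M - D - 1) * z by rewrite ler_pM2l.
have h2 : e * (M * x) <= M * z.
  by rewrite mulrCA ler_wpM2l//; apply: le_trans xz; rewrite ler_piMl// ltW.
have h3 : e * x ^+ 2 <= D * z.
  rewrite expr2 mulrA; apply: (le_trans (ler_wpM2r x0 ex)).
  by rewrite ler_wpM2l.
by lra.
Qed.

Lemma residual_bound (R : realType) (c x y z h h' : R) : 0 <= c -> 0 <= y ->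
  y <= x -> x <= z -> 0 <= h -> h <= h' ->
  0 <= h - c * (x - y) + (c + 1) * z <= (c + 1) * (h' + z).
Proof.
move=> c0 y0 yx xz h0 hh.
have p1 : c * (x - y) <= c * z by rewrite ler_wpM2l//; lra.
have p2 : 0 <= c * (x - y) by rewrite mulr_ge0//; lra.
have p3 : 0 <= c * h' by rewrite mulr_ge0//; lra.
by apply/andP; split; lra.
Qed.

Lemma sqr_entry_le (R : realType) n (v : 'cV[R]_n) a : v a 0 ^+ 2 <= sqnorm2 v.
Proof. by rewrite /sqnorm2 (bigD1 a)//= lerDl sumr_ge0// => i _; exact: sqr_ge0. Qed.

Lemma le_1Dsqr (R : realType) (x h : R) : x ^+ 2 <= h -> x <= 1 + h.
Proof. by move=> xh; have : 0 <= (x - 1) ^+ 2 by [exact: sqr_ge0]; nra. Qed.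

Section vanishing.
Variables (R : realType) (m n d : nat) (A : 'M[R]_(n, d)).
Hypothesis A_inj : forall v : 'cV[R]_d, A *m v = 0 -> v = 0.
Variables (disp : measure_display) (T : measurableType disp).
Variables (P : probability T R) (S : rmatrix P m n).
Hypotheses (dm : (d + 1 < m)%N) (gS : gaussian_sketch S).
Local Notation mx := 'M[R]_(m, n).
Local Notation Sw := (rmatrix_val S).
Local Notation EX g := (\int[P]_w (g : mx -> R) (Sw w)).
Local Notation K := (Kreg A).
Local Notation D0 M := (\det (gram A (reg 0 M))).

Let m0 : (0 < m)%N. Proof. exact: leq_ltn_trans dm. Qed.

Let dof : 0 < m%:R - d%:R - 1 :> R.
Proof. by rewrite -addrA -opprD -(natrD R d 1) subr_gt0 ltr_nat. Qed.

(** The regularization parameters, decreasing to 0. *)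
Let eps (r : nat) : R := harmonic r.

Let eps_gt0 r : 0 < eps r. Proof. by rewrite invr_gt0 ltr0n. Qed.
Let eps_le1 r : eps r <= 1. Proof. by rewrite invf_le1 ?ltr0n// ler1n. Qed.

Let mK delta a b : measurable_fun setT (fun w => K delta (Sw w) a b).
Proof. exact: (measurable_rmatrix S (@mborel_Kreg R m n d A delta a b)). Qed.

Lemma measurable_det0 : measurable_fun setT (fun w => D0 (Sw w)).
Proof.
suff b : borel (fun M : mx => D0 M) by exact: (measurable_rmatrix S b).
apply: (@borel_det _ _ _ _ (fun M : mx => gram A (reg 0 M))).
apply: mborel_mul; last exact: mborel_cst.
apply: mborel_mul; first exact: mborel_cst.
apply: mborelD; last exact: mborel_cst.
by apply: mborel_mul; [apply: mborel_tr|]; exact: mborel_id.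
Qed.

Let tame_regularized r : tame (fun M : mx => (m%:R - d%:R - 1) * \tr (K (eps r) M) +
  eps r * (m%:R * \tr (K (eps r) M) + \tr (K (eps r) M *m K (eps r) M)
    + \tr (K (eps r) M) ^+ 2)).
Proof.
have tt1 := tame_t1 m A_inj (eps_gt0 r); have tt2 := tame_t2 m A_inj (eps_gt0 r).
apply: tameD; first by apply: tameM => //; exact: tame_cst.
apply: tameM; first exact: tame_cst.
apply: tameD; last exact: tameM.
by apply: tameD => //; apply: tameM => //; exact: tame_cst.
Qed.

(** Singularity would make the trace of the regularized resolvent explode. *)
Lemma ae_nonsingular : {ae P, forall w, D0 (Sw w) != 0}.
Proof.
pose Z := [set w | D0 (Sw w) = 0].
have mZ : measurable Z.
  rewrite (_ : Z = (fun w => D0 (Sw w)) @^-1` [set 0])// -[X in measurable X]setTI.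
  exact: measurable_det0.
suff PZ : P Z = 0%E.
  exists Z; split=> // w /= nD; apply/eqP; apply: contra_notT nD.
  by move=> ->.
have iZ : P.-integrable setT (EFin \o \1_Z) by exact: integrable_indic.
have PZE : fine (P Z) = \int[P]_w \1_Z w.
  by rewrite /Rintegral integral_indic// setIT.
have bound r : (m%:R - d%:R - 1) * fine (P Z) <= eps r * (m%:R * d%:R).
  have tall := tame_regularized r.
  rewrite -(expect_trace A_inj m0 gS (eps_gt0 r)) PZE.
  rewrite -!RintegralZl//; last exact: (tame_integrable m0 gS tall).
  apply: le_Rintegral => //.
  - by apply: (integrableZl measurableT _ iZ).
  - by apply: (integrableZl measurableT _ (tame_integrable m0 gS tall)).
  move=> w _; have t10 := tr_Kreg_ge0 A_inj (Sw w) (eps_gt0 r).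
  have t20 := tr_KregK_ge0 A (eps r) (Sw w).
  rewrite mulrDr; apply: ler_wpDr.
    by rewrite !mulr_ge0 ?addr_ge0 ?mulr_ge0 ?sqr_ge0// ltW.
  rewrite mulrCA ler_pM2l//; rewrite indicE.
  have [/set_mem wZ|_] := boolP (w \in Z); last by rewrite mulr_ge0// ltW.
  exact: (tr_Kreg_singular A_inj (eps_gt0 r) wZ).
have PZ0 : fine (P Z) <= 0.
  rewrite -(pmulr_rle0 _ dof).
  have lim0 : eps r * (m%:R * d%:R) @[r --> \oo] --> (0 : R).
    by rewrite -(mul0r (m%:R * d%:R)); apply: cvgM; [exact: cvg_harmonic|exact: cvg_cst].
  rewrite -(cvg_lim _ lim0)//; apply: limr_ge; first by apply/cvg_ex; exists 0.
  by apply: nearW => r; exact: bound.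
apply/eqP; rewrite eq_le measure_ge0 andbT -(@fineK _ (P Z)) ?lee_fin//.
exact: fin_num_measure.
Qed.

Let K_cvg (M : mx) a b : D0 M != 0 -> K (eps r) M a b @[r --> \oo] --> K 0 M a b.
Proof.
move=> nz; pose C := \sum_k `|K 0 M a k| * (1 + \sum_l K 0 M l b ^+ 2).
suff H : `|K 0 M a b - K (eps r) M a b| @[r --> \oo] --> (0 : R).
  by apply: cvg_zero; apply: norm_cvg0; under eq_fun do rewrite distrC.
have lim0 : eps r * C @[r --> \oo] --> (0 : R).
  by rewrite -(mul0r C); apply: cvgM; [exact: cvg_harmonic|exact: cvg_cst].
refine (@squeeze_cvgr _ _ _ R (fun=> 0) (fun r => eps r * C) _ _ 0 _ lim0).
  by apply: nearW => r; rewrite normr_ge0 (Kreg_cvg_bound A_inj)//.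
exact: cvg_cst.
Qed.

Let t_cvg (M : mx) : D0 M != 0 -> \tr (K (eps r) M) @[r --> \oo] --> \tr (K 0 M).
Proof. by move=> nz; apply: cvg_bigsum => i; exact: K_cvg. Qed.

Let t2_cvg (M : mx) : D0 M != 0 -> \tr (K (eps r) M *m K (eps r) M) @[r --> \oo] -->
  \tr (K 0 M *m K 0 M).
Proof.
move=> nz; apply: cvg_bigsum => i.
rewrite (_ : (fun r => _) = fun r => \sum_j K (eps r) M i j * K (eps r) M j i); last first.
  by apply/funext => r; rewrite mxE.
by rewrite mxE; apply: cvg_bigsum => j; apply: cvgM; exact: K_cvg.
Qed.

Let eps_cvg0 (u : nat -> R) (l : R) : u @ \oo --> l ->
  eps r * u r @[r --> \oo] --> (0 : R).
Proof.
by move=> ul; rewrite -(mul0r l); apply: cvgM; [exact: cvg_harmonic|exact: ul].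
Qed.

Let t0 w := \tr (K 0 (Sw w)).

Lemma measurable_trK delta : measurable_fun setT (fun w => \tr (K delta (Sw w))).
Proof. by apply: measurable_sum => i; exact: mK. Qed.

Lemma measurable_trKK delta :
  measurable_fun setT (fun w => \tr (K delta (Sw w) *m K delta (Sw w))).
Proof.
apply: measurable_sum => i; under eq_fun do rewrite mxE.
by apply: measurable_sum => j; apply: measurable_funM; exact: mK.
Qed.

(** The limit of [expect_trace]; all the terms with a factor delta vanish. *)
Lemma expect_tr0 : P.-integrable setT (EFin \o t0) /\
  \int[P]_w t0 w = m%:R * d%:R / (m%:R - d%:R - 1).
Proof.
pose Q_ r w := (m%:R - d%:R - 1) * \tr (K (eps r) (Sw w)) +
  eps r * (m%:R * \tr (K (eps r) (Sw w)) + \tr (K (eps r) (Sw w) *m K (eps r) (Sw w))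
    + \tr (K (eps r) (Sw w)) ^+ 2).
pose Q w := (m%:R - d%:R - 1) * t0 w.
have [||||iQ EQ] := @limit_integral _ _ R P Q_ Q (2 * m%:R / (m%:R - d%:R - 1))
  (m%:R * d%:R).
- move=> r; apply: measurable_funD.
    by apply: measurable_funM => //; exact: measurable_trK.
  apply: measurable_funM => //; apply: measurable_funD.
    apply: measurable_funD; last exact: measurable_trKK.
    by apply: measurable_funM => //; exact: measurable_trK.
  by apply: measurable_funX; exact: measurable_trK.
- by apply: measurable_funM => //; exact: measurable_trK.
- move: ae_nonsingular; apply: ae_imply => w nz; split.
    move=> r; rewrite /Q_ /Q /t0.
    exact: (regularized_trace_bound (ler0n R m) dof (tr_Kreg_ge0 A_inj _ (eps_gt0 r))
      (tr_KregK_ge0 _ _ _) (tr_KregK_le A_inj _ (eps_gt0 r))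
      (tr_Kreg_le A_inj _ (eps_gt0 r)) (tr_Kreg_le0 A_inj (eps_gt0 r) nz)
      (eps_gt0 r) (eps_le1 r) (ler0n R d)).
  rewrite /Q_ /Q /t0 -[X in _ --> X]addr0; apply: cvgD.
    by apply: cvgM; [exact: cvg_cst|exact: t_cvg].
  apply: eps_cvg0; apply: cvgD; first apply: cvgD.
  - by apply: cvgM; [exact: cvg_cst|exact: t_cvg].
  - exact: t2_cvg.
  - by apply: cvg_sqr; exact: t_cvg.
- move=> r; rewrite -(expect_trace A_inj m0 gS (eps_gt0 r)) fineK//.
  apply: integrable_fin_num => //.
  exact: (tame_integrable m0 gS (tame_regularized r)).
have it0 : P.-integrable setT (EFin \o t0).
  have := integrableZl measurableT (m%:R - d%:R - 1)^-1 iQ.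
  apply: eq_integrable => // w _; rewrite /= -EFinM /Q mulKf//.
  by rewrite gt_eqF.
split=> //; move: EQ; rewrite RintegralZl// => EQ.
by rewrite -EQ mulrAC mulfV ?mul1r// gt_eqF.
Qed.

Section residual.
Variable b : 'cV[R]_n.
Hypothesis Ab : A^T *m b = 0.

(** The regularized form of the error A (x - xs) of a sketched solution, for the
    optimal residual [b]. *)
Definition proj_err delta (M : mx) : 'cV[R]_n := K delta M *m (M^T *m (M *m b)).

Let mtame_proj_err r : mtame (proj_err (eps r)).
Proof.
apply: mtame_mul; first exact: (mtame_Kreg m A_inj (eps_gt0 r)).
apply: mtame_mul; first by apply: mtame_tr; exact: mtame_id.
by apply: mtame_mul; [exact: mtame_id|exact: mtame_cst].
Qed.

Let mborel_proj_err delta : mborel (proj_err delta).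
Proof.
apply: mborel_mul; first exact: mborel_Kreg.
apply: mborel_mul; first by apply: mborel_tr; exact: mborel_id.
by apply: mborel_mul; [exact: mborel_id|exact: mborel_cst].
Qed.

Let measurable_proj_err a : measurable_fun setT (fun w => proj_err 0 (Sw w) a 0).
Proof. exact: (measurable_rmatrix S (@mborel_proj_err 0 a 0)). Qed.

Let measurable_sq0 : measurable_fun setT (fun w => sqnorm2 (proj_err 0 (Sw w))).
Proof.
by apply: measurable_sum => a; apply: measurable_funX; exact: measurable_proj_err.
Qed.

Let proj_err_cvg (M : mx) a : D0 M != 0 ->
  proj_err (eps r) M a 0 @[r --> \oo] --> proj_err 0 M a 0.
Proof.
move=> nz; rewrite /proj_err; set v := M^T *m (M *m b).
rewrite (_ : (fun r => _) = fun r => \sum_c K (eps r) M a c * v c 0); last first.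
  by apply/funext => r; rewrite mxE.
by rewrite mxE; apply: cvg_bigsum => c; apply: cvgM; [exact: K_cvg|exact: cvg_cst].
Qed.

Let sq_cvg (M : mx) : D0 M != 0 ->
  sqnorm2 (proj_err (eps r) M) @[r --> \oo] --> sqnorm2 (proj_err 0 M).
Proof. by move=> nz; apply: cvg_bigsum => a; apply: cvg_sqr; exact: proj_err_cvg. Qed.

(** The limit of [expect_sqnorm2]. Adding a multiple of the trace makes the
    regularized terms nonnegative and dominated by a multiple of their limit. *)
Lemma expect_sqnorm0 :
  P.-integrable setT (EFin \o (fun w => sqnorm2 (proj_err 0 (Sw w)))) /\
  \int[P]_w sqnorm2 (proj_err 0 (Sw w)) = sqnorm2 b * (d%:R / (m%:R - d%:R - 1)).
Proof.
have [it0 Et0] := expect_tr0.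
pose c := m%:R^-1 * sqnorm2 b.
have c0 : 0 <= c by rewrite mulr_ge0 ?sqnorm2_ge0// invr_ge0.
pose t12 r (M : mx) := \tr (K (eps r) M) - eps r * \tr (K (eps r) M *m K (eps r) M).
have tt r : tame (t12 r).
  exact: (tameB (tame_t1 m A_inj (eps_gt0 r))
    (tameM (tame_cst m n (eps r)) (tame_t2 m A_inj (eps_gt0 r)))).
have tsq r : tame (fun M => sqnorm2 (proj_err (eps r) M)).
  apply: tame_sum => a.
  apply: (tame_eq (tameM (mtame_proj_err r a 0) (mtame_proj_err r a 0))) => M.
  by rewrite expr2.
pose g r (M : mx) := sqnorm2 (proj_err (eps r) M) - c * t12 r M.
have tg r : tame (g r) by exact: (tameB (tsq r) (tameM (tame_cst m n c) (tt r))).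
have Eg r : EX (g r) = 0.
  rewrite [LHS](EXB m0 gS (tsq r) (tameM (tame_cst m n c) (tt r))).
  rewrite [X in _ - X](EXZ m0 gS c (tt r)).
  by rewrite (expect_sqnorm2 A_inj m0 gS (eps_gt0 r) Ab) subrr.
pose Q_ r w := g r (Sw w) + (c + 1) * t0 w.
pose Q w := sqnorm2 (proj_err 0 (Sw w)) + t0 w.
have iz : P.-integrable setT (EFin \o (fun w => (c + 1) * t0 w)).
  exact: (integrableZl measurableT (c + 1) it0).
have ig r := tame_integrable m0 gS (tg r).
have [||||iQ EQ] := @limit_integral _ _ R P Q_ Q (c + 1)
    ((c + 1) * (m%:R * d%:R / (m%:R - d%:R - 1))).
- move=> r; apply: measurable_funD.
    by have [bg _ _] := tg r; exact: (measurable_rmatrix S bg).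
  by apply: measurable_funM => //; exact: measurable_trK.
- by apply: measurable_funD; [exact: measurable_sq0|exact: measurable_trK].
- move: ae_nonsingular; apply: ae_imply => w nz; split.
    move=> r; rewrite /Q_ /Q /g /t12 /t0.
    exact: (residual_bound c0
      (mulr_ge0 (ltW (eps_gt0 r)) (tr_KregK_ge0 A (eps r) (Sw w)))
      (tr_KregK_le A_inj (Sw w) (eps_gt0 r)) (tr_Kreg_le0 A_inj (eps_gt0 r) nz)
      (sqnorm2_ge0 _) (sqnorm2_Kreg_le A_inj (eps_gt0 r) nz _)).
  rewrite /Q_ /Q /g /t12 /t0.
  rewrite [X in _ --> X](_ : _ = sqnorm2 (proj_err 0 (Sw w)) - c * (t0 w - 0) +
    (c + 1) * t0 w); last by rewrite /t0; ring.
  apply: cvgD; last exact: cvg_cst.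
  apply: cvgB.
    exact: sq_cvg.
  apply: cvgM; first exact: cvg_cst.
  apply: cvgB; first exact: t_cvg.
  by apply: eps_cvg0; exact: t2_cvg.
- move=> r; rewrite -Et0 -RintegralZl//.
  have iQr : P.-integrable setT (EFin \o Q_ r) by exact: (integrableD measurableT (ig r) iz).
  rewrite -(fineK (integrable_fin_num measurableT iQr)); congr EFin.
  rewrite -[LHS]/(\int[P]_w Q_ r w) /Q_ (RintegralD measurableT (ig r) iz).
  by rewrite -[X in X + _]/(EX (g r)) Eg add0r.
have isq : P.-integrable setT (EFin \o (fun w => sqnorm2 (proj_err 0 (Sw w)))).
  have := integrableB measurableT iQ it0.
  by apply: eq_integrable => // w _; rewrite /= -EFinB /Q addrK.
split=> //; move: EQ; rewrite /Q RintegralD// Et0 => /(canRL (addrK _)) ->.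
rewrite /c; have mN0 : m%:R != 0 :> R by rewrite pnatr_eq0 -lt0n.
by field; rewrite mN0 gt_eqF.
Qed.

Lemma expect_entry0 a : \int[P]_w proj_err 0 (Sw w) a 0 = 0.
Proof.
have [isq _] := expect_sqnorm0.
have ie : P.-integrable setT (fun w => (1 + sqnorm2 (proj_err 0 (Sw w)))%:E).
  have i1 : P.-integrable setT (EFin \o (fun=> 1 : R)).
    exact: finite_measure_integrable_cst.
  exact: (integrableD measurableT i1 isq).
have [_ _ cv] : [/\ P.-integrable setT (EFin \o (fun w => proj_err 0 (Sw w) a 0)),
    (fun r => \int[P]_w `|(proj_err (eps r) (Sw w) a 0)%:E
       - (proj_err 0 (Sw w) a 0)%:E|)%E @ \oo --> 0%E &
    (fun r => \int[P]_w (proj_err (eps r) (Sw w) a 0)%:E)%E @ \oo -->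
      (\int[P]_w (proj_err 0 (Sw w) a 0)%:E)%E].
  apply: (@dominated_convergence _ _ R P setT measurableT
    (fun r w => (proj_err (eps r) (Sw w) a 0)%:E)
    (EFin \o (fun w => proj_err 0 (Sw w) a 0))
    (fun w => (1 + sqnorm2 (proj_err 0 (Sw w)))%:E)) => //.
  - move=> r; apply/measurable_EFinP.
    exact: (measurable_rmatrix S (@mborel_proj_err (eps r) a 0)).
  - by apply/measurable_EFinP; exact: measurable_proj_err.
  - move: ae_nonsingular; apply: ae_imply => w nz _ /=.
    by apply: cvg_EFin; [exact: nearW|exact: proj_err_cvg].
  - move: ae_nonsingular; apply: ae_imply => w nz r _ /=; rewrite lee_fin.
    apply: le_1Dsqr; rewrite real_normK ?num_real//.
    apply: le_trans (sqnorm2_Kreg_le A_inj (eps_gt0 r) nz _).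
    exact: sqr_entry_le.
rewrite /Rintegral (_ : 0 = fine (0%:E : \bar R))//; congr fine.
apply: (cvg_unique _ cv) => //.
rewrite (_ : (fun r => _) = fun=> 0%E); first exact: cvg_cst.
apply/funext => r.
have it := tame_integrable m0 gS (mtame_proj_err r a 0).
rewrite -(fineK (integrable_fin_num measurableT it)); congr EFin.
exact: (expect_entry A_inj m0 gS (eps_gt0 r) Ab a).
Qed.

End residual.
End vanishing.

(** * Least squares minimizers *)

Lemma normal_equation (R : realType) m d (M : 'M[R]_(m, d)) (y : 'cV[R]_m) x :
  argmin (lsq M y) x -> M^T *m (M *m x - y) = 0.
Proof.
move=> xmin; set v := M^T *m _; apply/eqP; rewrite -sqnorm2_eq0.
have v0 := sqnorm2_ge0 v; have Mv0 := sqnorm2_ge0 (M *m v).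
(* the exact step that minimizes along v, up to the harmless 1 in the denominator *)
pose t := sqnorm2 v / (1 + sqnorm2 (M *m v)).
have B0 : 0 < 1 + sqnorm2 (M *m v) by rewrite ltr_wpDr.
have t0 : 0 <= t by rewrite divr_ge0// ltW.
have tB : t * (1 + sqnorm2 (M *m v)) = sqnorm2 v by rewrite divfK// gt_eqF.
have := xmin (x - t *: v); rewrite /lsq.
have -> : M *m (x - t *: v) - y = (M *m x - y) + (- t) *: (M *m v).
  by rewrite mulmxBr -scalemxAr scaleNr addrAC.
rewrite [leRHS]sqnorm2D sqnorm2Z -addrA lerDl.
have -> : ((M *m x - y)^T *m ((- t) *: (M *m v))) 0 0 = - t * sqnorm2 v.
  by rewrite -scalemxAr [LHS]mxE dotmxC trmx_mul -mulmxA -/v -sqnorm2E.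
move: (sqnorm2 v) (sqnorm2 (M *m v)) v0 Mv0 tB => V B V0 _ tB h.
have tE : t ^+ 2 * B = t * V - t ^+ 2 by rewrite -tB; ring.
have t20 : 0 <= t ^+ 2 by exact: sqr_ge0.
have tV0 : 0 <= t * V by exact: mulr_ge0.
have : t ^+ 2 = 0 by move: h; rewrite sqrrN tE; lra.
by move/eqP; rewrite sqrf_eq0 => /eqP tz; rewrite -tB tz mul0r.
Qed.

Lemma sqnorm2N (R : realType) n (v : 'cV[R]_n) : sqnorm2 (- v) = sqnorm2 v.
Proof. by rewrite -scaleN1r sqnorm2Z sqrrN expr1n mul1r. Qed.

(** The cross term vanishes by the normal equation. *)
Lemma lsq_excess (R : realType) n d (A : 'M[R]_(n, d)) (b : 'cV[R]_n) xs x :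
  argmin (lsq A b) xs -> lsq A b x = lsq A b xs + sqnorm2 (A *m (x - xs)).
Proof.
move=> /normal_equation ne; rewrite /lsq.
have -> : A *m x - b = (A *m xs - b) + A *m (x - xs).
  by rewrite mulmxBr addrAC subrKC.
rewrite sqnorm2D [X in 2 * X](_ : _ = 0) ?mulr0 ?addr0//.
by rewrite dotmxC trmx_mul -mulmxA ne mulmx0 mxE.
Qed.

Lemma argmin_inj (R : realType) n d (A : 'M[R]_(n, d)) (b : 'cV[R]_n) xs :
  argmin (lsq A b) = [set xs] -> forall v : 'cV[R]_d, A *m v = 0 -> v = 0.
Proof.
move=> am v Av; have xsm : argmin (lsq A b) xs by rewrite am.
have : argmin (lsq A b) (xs + v).
  by move=> y; rewrite /lsq mulmxDr Av addr0; exact: xsm.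
by rewrite am => /(canRL (addKr _)) ->; rewrite addNr.
Qed.

(** A sketched solution differs from the optimum by the sketched regression of
    the optimal residual. *)
Lemma sketched_error (R : realType) m n d (A : 'M[R]_(n, d)) (b : 'cV[R]_n) xs
    (M : 'M[R]_(m, n)) x :
  \det (gram A (reg 0 M)) != 0 -> argmin (lsq (M *m A) (M *m b)) x ->
  A *m (x - xs) = proj_err A (b - A *m xs) 0 M.
Proof.
move=> nz /normal_equation ne; rewrite /proj_err /Kreg /resolvent.
have Wx : gram A (reg 0 M) *m (x - xs) = A^T *m (M^T *m (M *m (b - A *m xs))).
  apply/eqP; rewrite -subr_eq0 -ne /gram /reg raddf0 addr0 trmx_mul.
  by rewrite !(mulmxBr, mulmxA) opprB addrA subrK.
by rewrite -[in RHS]mulmxA -Wx -[in RHS]mulmxA [adjinv _ *m _]mulmxA adjinvK// mul1mx.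
Qed.

(** * Averaging independent sketches *)

Lemma normM_le_sqr (R : realType) (x y X Y : R) :
  x ^+ 2 <= X -> y ^+ 2 <= Y -> `|x * y| <= X + Y.
Proof.
rewrite normrM -(real_normK (num_real x)) -(real_normK (num_real y)).
move: (`|x|) (`|y|) => a c aX cY; have : 0 <= (a - c) ^+ 2 by exact: sqr_ge0.
by have := sqr_ge0 a; have := sqr_ge0 c; rewrite sqrrB => *; lra.
Qed.

Section averaging.
Variables (R : realType) (q m d n : nat) (alg : dist_alg R q m d).
Variables (A : 'M[R]_(n, d)) (b : 'cV[R]_n) (xs : 'cV[R]_d).
Variables (disp : measure_display) (T : measurableType disp) (P : probability T R).
Variable (S : 'I_q -> rmatrix P m n).
Hypotheses (q0 : (0 < q)%N) (dm : (d + 1 < m)%N).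
Hypothesis algP : dist_randomized_regression alg.
Hypothesis xsP : argmin (lsq A b) = [set xs].
Hypothesis gS : forall k, gaussian_sketch (S k).
Hypothesis indepS : mutually_independent P (fun k => sigma_rmatrix (S k)).
Local Notation mx := 'M[R]_(m, n).

Let A_inj : forall v : 'cV[R]_d, A *m v = 0 -> v = 0.
Proof. exact: argmin_inj xsP. Qed.

Let xs_min : argmin (lsq A b) xs. Proof. by rewrite xsP. Qed.

Let r := b - A *m xs.

Let Ar : A^T *m r = 0.
Proof. by rewrite /r -opprB mulmxN (normal_equation xs_min) oppr0. Qed.

Let dof : 0 < m%:R - d%:R - 1 :> R.
Proof. by rewrite -addrA -opprD -(natrD R d 1) subr_gt0 ltr_nat. Qed.

Definition worker_err (M : mx) : 'cV[R]_n :=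
  A *m (worker_output alg (M *m A) (M *m b) - xs).

Let u k w := worker_err (rmatrix_val (S k) w).

Let borel_err a : borel (fun M => worker_err M a 0).
Proof.
move=> disp' T' F mF; rewrite /worker_err.
under eq_fun do rewrite mxE; apply: measurable_sum => j.
apply: measurable_funM; first exact: measurable_cst.
under eq_fun do rewrite mxE [(- _ : 'cV__) _ _]mxE.
apply: measurable_funD; last exact: measurable_cst.
exact: borel_worker.
Qed.

Let measurable_u k a : measurable_fun setT (fun w => u k w a 0).
Proof. exact: (measurable_rmatrix (S k) (borel_err a)). Qed.

Let ae_u k : {ae P, forall w, u k w = proj_err A r 0 (rmatrix_val (S k) w)}.
Proof.
move: (ae_nonsingular A_inj dm (gS k)); apply: ae_imply => w nz.
exact: sketched_error nz (algP.1 _ _).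
Qed.

Let measurable_sq k : measurable_fun setT (fun w => sqnorm2 (u k w)).
Proof. by apply: measurable_sum => a; apply: measurable_funX. Qed.

Let measurable_proj k a :
  measurable_fun setT (fun w => proj_err A r 0 (rmatrix_val (S k) w) a 0).
Proof.
suff H : mborel (fun M : mx => proj_err A r 0 M).
  exact: (measurable_rmatrix (S k) (H a 0)).
apply: mborel_mul; first exact: mborel_Kreg.
apply: mborel_mul; first by apply: mborel_tr; exact: mborel_id.
by apply: mborel_mul; [exact: mborel_id|exact: mborel_cst].
Qed.

Let ae_integrable (f g : T -> R) : measurable_fun setT f ->
  {ae P, forall w, f w = g w} -> P.-integrable setT (EFin \o g) ->
  P.-integrable setT (EFin \o f) /\ \int[P]_w f w = \int[P]_w g w.
Proof.
move=> mf fg ig; have mg := measurable_int _ ig.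
have mf' : measurable_fun setT (EFin \o f) by exact/measurable_EFinP.
split; last first.
  by congr fine; apply: ae_eq_integral => //; move: fg; apply: ae_imply => w /= ->.
apply/integrableP; split => //; move/integrableP : ig => [_]; apply: le_lt_trans.
rewrite le_eqVlt; apply/orP; left; apply/eqP; apply: ae_eq_integral => //.
- exact: measurableT_comp mf'.
- exact: measurableT_comp mg.
by move: fg; apply: ae_imply => w /= ->.
Qed.

Let sq_u k : P.-integrable setT (EFin \o (fun w => sqnorm2 (u k w))) /\
  \int[P]_w sqnorm2 (u k w) = sqnorm2 r * (d%:R / (m%:R - d%:R - 1)).
Proof.
have [ip Ep] := expect_sqnorm0 A_inj dm (gS k) Ar; rewrite -Ep.
apply: ae_integrable => //.
by move: (ae_u k); apply: ae_imply => w ->.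
Qed.

Let uu_integrable k l a :
  P.-integrable setT (EFin \o (fun w => u k w a 0 * u l w a 0)).
Proof.
have := integrableD measurableT (sq_u k).1 (sq_u l).1.
apply: le_integrable => //; first exact/measurable_EFinP/measurable_funM.
move=> w _ /=; rewrite lee_fin; apply: le_trans (ler_norm _).
exact: normM_le_sqr (sqr_entry_le _ _) (sqr_entry_le _ _).
Qed.

Let u_integrable k a : P.-integrable setT (EFin \o (fun w => u k w a 0)) /\
  \int[P]_w u k w a 0 = 0.
Proof.
rewrite -(expect_entry0 A_inj dm (gS k) Ar a); apply: ae_integrable => //.
  by move: (ae_u k); apply: ae_imply => w ->.
have [isq _] := expect_sqnorm0 A_inj dm (gS k) Ar.
have i1 : P.-integrable setT (EFin \o (fun=> 1 : R)).
  exact: finite_measure_integrable_cst.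
have := integrableD measurableT i1 isq.
apply: le_integrable => //; first exact/measurable_EFinP.
move=> w _ /=; rewrite lee_fin; apply: le_trans (ler_norm _).
by apply: le_1Dsqr; rewrite real_normK ?num_real// sqr_entry_le.
Qed.

(** Each error is a function of its own sketch, so it is measurable for the
    sigma-algebra of this sketch, to which the independence applies. *)
Let generators k : set (set T) :=
  \bigcup_(ij in [set: 'I_m * 'I_n]) sigma_rv (S k ij.1 ij.2).

Let generators_measurable k : generators k `<=` measurable.
Proof.
by move=> _ [ij _ [B mB <-]]; rewrite -[X in measurable X]setTI; exact: measurable_funP.
Qed.

Let Tk k := g_sigma_algebraType (generators k).

Let mY k : measurable_fun setT (fun w : T => w : Tk k).
Proof.
move=> _ E mE; rewrite setTI.
apply: (smallest_sub _ (@generators_measurable k)) mE; exact: sigma_algebra_measurable.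
Qed.

Let Y k : {mfun T >-> Tk k} := mfun_of (@mY k).

Let measurable_u_Tk k a : measurable_fun setT (fun w : Tk k => u k w a 0).
Proof.
apply: (borel_err a) => i j; under eq_fun do rewrite mxE.
move=> _ B mB; rewrite setTI; apply: sub_sigma_algebra; exists (i, j) => //.
by exists B.
Qed.

Let indep_pair k l : k != l -> forall E F, <<s generators k >> E ->
  <<s generators l >> F -> (P (E `&` F) = P E * P F)%E.
Proof.
move=> kl E F sE sF.
pose H i := if i == k then E else if i == l then F else setT.
have sH i : sigma_rmatrix (S i) (H i).
  rewrite /H; case: eqP => [->//|_]; case: eqP => [->//|_].
  exact: (@measurableT _ (Tk i)).
have := @indepS [set k; l]%SET H sH.
rewrite big_setU1 ?inE//= big_set1 /H eqxx eq_sym (negbTE kl) eqxx => <-.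
congr (P _); apply/seteqP; split=> w.
  move=> [Ew Fw] i /=; rewrite !inE => /orP[/eqP->|/eqP->].
    by rewrite eqxx.
  by rewrite eq_sym (negbTE kl) eqxx.
move=> Hw; split.
  by have := Hw k; rewrite /= !inE eqxx => /(_ isT).
by have := Hw l; rewrite /= !inE eqxx orbT eq_sym (negbTE kl) => /(_ isT).
Qed.

(** Under the product of the laws, the integral factors through the null mean of
    the first error. *)
Let cross k l a : k != l -> \int[P]_w (u k w a 0 * u l w a 0) = 0.
Proof.
move=> kl; pose f (z : Tk k * Tk l) := (u k z.1 a 0 * u l z.2 a 0)%:E.
have mf : measurable_fun setT f.
  apply/measurable_EFinP/measurable_funM.
    exact: (measurableT_comp (@measurable_u_Tk k a) measurable_fst).
  exact: (measurableT_comp (@measurable_u_Tk l a) measurable_snd).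
have [||fi fE] := @indep_integral _ _ _ T (Tk k) (Tk l) R P (Y k) (Y l) f _ mf.
- by move=> E F mE mF; exact: (indep_pair kl).
- exact: uu_integrable.
have iYk : (distribution P (Y k)).-integrable setT (fun w : Tk k => (u k w a 0)%:E).
  apply: (@integrable_pushforward _ _ _ _ _ _ (@mY k)) => //.
    by apply/measurable_EFinP; exact: measurable_u_Tk.
  exact: (u_integrable k a).1.
have EYk : (\int[distribution P (Y k)]_w (u k w a 0)%:E = 0)%E.
  rewrite integral_distribution.
  - have [iu Eu] := u_integrable k a.
    by rewrite -[LHS](fineK (integrable_fin_num measurableT iu)) -[fine _]/(\int[P]_w u k w a 0) Eu.
  - by apply/measurable_EFinP; exact: measurable_u_Tk.
  - exact: (u_integrable k a).1.
rewrite /Rintegral (_ : 0 = fine (0%:E : \bar R))//; congr fine.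
rewrite -[LHS]/(\int[P]_w f (Y k w, Y l w))%E fE -integral21_prod_meas1//.
apply: integral0_eq => w _; rewrite /fubini_G /f /=.
under eq_integral do rewrite mulrC EFinM.
by rewrite integralZl// EYk mule0.
Qed.

(** The off-diagonal terms of the expanded square have null expectation. *)
Lemma expect_average :
  P.-integrable setT (EFin \o (fun w => sqnorm2 (q%:R^-1 *: \sum_k u k w))) /\
  \int[P]_w sqnorm2 (q%:R^-1 *: \sum_k u k w) =
    sqnorm2 r * (q%:R^-1 * (d%:R / (m%:R - d%:R - 1))).
Proof.
have E w : sqnorm2 (q%:R^-1 *: \sum_k u k w) =
    q%:R^-1 ^+ 2 * \sum_a \sum_k \sum_l (u k w a 0 * u l w a 0).
  rewrite sqnorm2Z; congr (_ * _); apply: eq_bigr => a _.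
  rewrite summxE expr2 mulr_suml; apply: eq_bigr => k _.
  by rewrite mulr_sumr.
have sum_int (I : finType) (f : I -> T -> R) :
    (forall i, P.-integrable setT (EFin \o f i)) ->
    P.-integrable setT (EFin \o (fun w => \sum_i f i w)) /\
    \int[P]_w (\sum_i f i w) = \sum_i \int[P]_w f i w.
  move=> fi; elim: (index_enum I) => [|i s [IH1 IH2]].
    rewrite (_ : (fun w => _) = fun=> 0); last by apply/funext => w; rewrite big_nil.
    split; first exact: finite_measure_integrable_cst.
    by rewrite big_nil Rintegral_cst// mul0r.
  rewrite (_ : (fun w => _) = fun w => f i w + \sum_(j <- s) f j w); last first.
    by apply/funext => w; rewrite big_cons.
  split; first exact: (integrableD measurableT (fi i) IH1).
  by rewrite (RintegralD measurableT (fi i) IH1) IH2 big_cons.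
have iak a k := sum_int _ _ (uu_integrable k ^~ a).
have ia a := sum_int _ _ (fun k => (iak a k).1).
have ii := sum_int _ _ (fun a => (ia a).1).
rewrite (_ : (fun w => _) = fun w =>
  q%:R^-1 ^+ 2 * \sum_a \sum_k \sum_l (u k w a 0 * u l w a 0)); last exact/funext.
split; first exact: (integrableZl measurableT (q%:R^-1 ^+ 2) ii.1).
rewrite (RintegralZl _ measurableT ii.1) ii.2.
transitivity (q%:R^-1 ^+ 2 * \sum_(k < q) \int[P]_w sqnorm2 (u k w)).
  congr (_ * _).
  have isq k a := uu_integrable k k a.
  transitivity (\sum_a \sum_k \int[P]_w (u k w a 0 * u k w a 0)).
    apply: eq_bigr => a _; rewrite (ia a).2; apply: eq_bigr => k _.
    rewrite (iak a k).2 (bigD1 k)//= big1 ?addr0// => l lk.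
    by apply: cross; rewrite eq_sym.
  rewrite exchange_big; apply: eq_bigr => k _.
  rewrite -(sum_int _ _ (isq k)).2; apply: eq_Rintegral => w _.
  by apply: eq_bigr => a _; rewrite expr2.
under eq_bigr do rewrite (sq_u _).2.
rewrite sumr_const card_ord -mulr_natr.
have qN0 : q%:R != 0 :> R by rewrite pnatr_eq0 -lt0n.
by field; rewrite qN0 gt_eqF.
Qed.

End averaging.

Theorem mainTheorem2 (R : realType) :
  (exists C : nat, forall q m d : nat, (0 < q)%N -> (d + 1 < m)%N ->
     exists alg : dist_alg R q m d, dist_randomized_regression alg /\
       forall (SA : 'I_q -> 'M[R]_(m, d)) (Sb : 'I_q -> 'cV[R]_m),
         (workers_time alg SA Sb <= C * (m * d ^ 2))%N /\
         (running_time alg SA Sb <= C * (m * d ^ 2 + q * d))%N)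
  /\
  (forall (q m d n : nat) (alg : dist_alg R q m d)
     (A : 'M[R]_(n, d)) (b : 'cV[R]_n) (xs : 'cV[R]_d)
     (disp : measure_display) (T : measurableType disp) (P : probability T R)
     (S : 'I_q -> rmatrix P m n),
     (0 < q)%N -> (d + 1 < m)%N ->
     dist_randomized_regression alg ->
     argmin (lsq A b) = [set xs] ->
     lsq A b xs != 0 ->
     (forall k, gaussian_sketch (S k)) ->
     mutually_independent P (fun k => sigma_rmatrix (S k)) ->
     let f := lsq A b in
     let xbar := fun w : T =>
       returned alg (fun k => rmatrix_val (S k) w *m A)
                    (fun k => rmatrix_val (S k) w *m b) in
     (('E_P[fun w => f (xbar w)] - (f xs)%:E) / (f xs)%:E =
        (q%:R^-1 * (d%:R / (m%:R - d%:R - 1)))%:E)%E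
     /\
     (forall eps : R, 0 < eps ->
        ((1 - (q%:R * eps)^-1 * (d%:R / (m%:R - d%:R - 1)))%:E <=
         P [set w | ((f (xbar w) - f xs) / f xs <= eps)%R])%E)).
Proof.
split.
  exists 11%N => q m d q0 dm.
  exact: dist_alg_exists q0 (leq_ltn_trans (leq0n _) dm).
move=> q m d n alg A b xs disp T P S q0 dm algP xsP fs0 gS indepS f xbar.
have xs_min : argmin (lsq A b) xs by rewrite xsP.
have fs_gt0 : 0 < f xs by rewrite lt0r fs0 sqnorm2_ge0.
pose rate : R := d%:R / (m%:R - d%:R - 1).
pose u k w := worker_err alg A b xs (rmatrix_val (S k) w).
pose g w := sqnorm2 (q%:R^-1 *: \sum_k u k w).
have fE w : f (xbar w) = f xs + g w.
  rewrite /f (lsq_excess _ xs_min); congr (_ + sqnorm2 _).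
  rewrite /xbar /returned algP.2 /u /worker_err.
  rewrite -mulmx_sumr sumrB scalemxAr scalerBr; congr (_ *m (_ - _)).
  by rewrite sumr_const card_ord -[xs *+ q]scaler_nat scalerA mulVf ?scale1r// pnatr_eq0 -lt0n.
have [ig Eg] : P.-integrable setT (EFin \o g) /\ \int[P]_w g w = f xs * (q%:R^-1 * rate).
  rewrite (_ : f xs = sqnorm2 (b - A *m xs)).
    exact: (expect_average q0 dm algP xsP gS indepS).
  by rewrite /f /lsq -sqnorm2N opprB.
have g0 w : 0 <= g w by exact: sqnorm2_ge0.
have mg : measurable_fun setT g by apply/measurable_EFinP; exact: measurable_int ig.
split.
  have -> : 'E_P[fun w => f (xbar w)]%E = (f xs + f xs * (q%:R^-1 * rate))%:E.
    rewrite unlock; under eq_integral do rewrite fE.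
    have ic : P.-integrable setT (EFin \o (fun=> f xs)).
      exact: finite_measure_integrable_cst.
    have iS : P.-integrable setT (EFin \o (fun w => f xs + g w)).
      exact: (integrableD measurableT ic ig).
    rewrite -[LHS](fineK (integrable_fin_num measurableT iS)); congr EFin.
    apply: (etrans (RintegralD measurableT ic ig)).
    rewrite Eg Rintegral_cst//.
    have /= -> := probability_setT P.
    by rewrite mulr1.
  rewrite -EFinB inver (negbTE fs0) -EFinM; congr EFin.
  by rewrite addrC addKr mulrAC mulfV// mul1r.
move=> eps eps0; pose B := [set w | eps < g w / f xs].
have ratioE w : (f (xbar w) - f xs) / f xs = g w / f xs by rewrite fE addrC addKr.
have mB : measurable B.
  have -> : B = (fun w => g w / f xs) @^-1` `]eps, +oo[.
    by apply/seteqP; split=> w /=; rewrite in_itv/= andbT.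
  rewrite -[X in measurable X]setTI.
  by apply: measurable_funM => //; exact: measurable_cst.
have -> : [set w | (f (xbar w) - f xs) / f xs <= eps] = ~` B.
  by apply/seteqP; split=> w /=; rewrite /B /= ratioE leNgt => /negP.
rewrite probability_setC// -(fineK (fin_num_measure P _ mB)) -EFinB lee_fin lerD2l lerN2.
have iB : P.-integrable setT (EFin \o \1_B) by exact: integrable_indic.
have PBE : fine (P B) = \int[P]_w \1_B w.
  by rewrite /Rintegral integral_indic// setIT.
(* Markov's inequality *)
have : eps * f xs * fine (P B) <= \int[P]_w g w.
  rewrite PBE -(RintegralZl _ measurableT iB).
  apply: le_Rintegral => //; first exact: (integrableZl measurableT _ iB).
  move=> w _; rewrite indicE; have [/set_mem|_] := boolP (w \in B).
    by rewrite /B /= mulr1 ltr_pdivlMr// => /ltW.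
  by rewrite mulr0.
rewrite Eg -/rate => h.
have -> : (q%:R * eps)^-1 * rate = eps^-1 * (q%:R^-1 * rate).
  by rewrite invfM -mulrA mulrCA.
by rewrite ler_pdivlMl// -(ler_pM2l fs_gt0) mulrA (mulrC (f xs)).
Qed.
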